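(* Let $H$ satisfy conditions A, B and C, and suppose that either Case (i) holds and $\Omega$ is any bounded domain, or Case (ii) holds and $\Omega$ satisfies a uniform outer ball condition. Let $\delta>0$, $a\in C(\Omega)\cap L^\infty(\Omega)$, $\inf_\Omega a>0$, and $h\in C(\partial\Omega)$ with $\inf_{\partial\Omega}h>0$. Suppose that, for some $\lambda>0$, the problem $$H(Du,D^2u)+\lambda a(x)|u|^{k-1}u=0\ \text{ in }\Omega,\qquad u=\delta\ \text{ on }\partial\Omega,$$ has a positive solution $u\in C(\overline\Omega)$. Then the problem $$H(Dv,D^2v)+\lambda a(x)|v|^{k-1}v=0\ \text{ in }\Omega,\qquad v=h\ \text{ on }\partial\Omega,$$ also has a positive solution $v\in C(\overline\Omega)$.
   Context: $\Omega\subset\mathbb{R}^n$, $n\ge2$, is a bounded domain; $S^n$ is the set of real symmetric $n\times n$ matrices, $O$ the zero matrix, $I$ the identity, $e$ always a unit vector in $\mathbb{R}^n$. Equations are understood in the viscosity sense. $H:\mathbb{R}^n\times S^n\to\mathbb{R}$ is continuous with $H(p,O)=0$ for all $p$. Condition A (monotonicity): $X\le Y$ implies $H(p,X)\le H(p,Y)$ for all $p$. Condition B (homogeneity): there are constants $k_1\ge0$ and $k_2>0$, an odd integer, with $H(\theta p,X)=|\theta|^{k_1}H(p,X)$ for all $\theta\in\mathbb{R}$ and $H(p,\theta X)=\theta^{k_2}H(p,X)$ for all $\theta>0$. Set $k=k_1+k_2$. Condition C (coercivity): for $s\in\mathbb{R}$ put $$m_1(s)=\min\Big\{\min_{|e|=1}H(e,I-se\otimes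 e),\,-\max_{|e|=1}H(e,se\otimes e-I)\Big\},$$ $$m_2(s)=\max\Big\{\max_{|e|=1}H(e,I-se\otimes e),\,-\min_{|e|=1}H(e,se\otimes e-I)\Big\}.$$ Then $m_1(k_1/k)>0$, and there are $-\infty<s_1\le1\le s_0<\infty$ and $0<\ell<\infty$ with $m_1(s)>0$ for all $s\le s_1$ and $m_2(s)<-\ell$ for all $s\ge s_0$. Case (i): there is $1<\bar s<2$ such that $m_2(\bar s)<0$. Case (ii): there is $\bar s\ge2$ such that $m_2(s)<0$ for all $s>\bar s$. Uniform outer ball condition: there is $\rho>0$ such that for every $y\in\partial\Omega$ there is $z\in\mathbb{R}^n$ with $B_\rho(z)\subset\mathbb{R}^n\setminus\Omega$ and $y\in\partial B_\rho(z)$. *)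

(* Defs.v *)
From HB Require Import structures.
From mathcomp Require Import all_boot all_order all_algebra.
From mathcomp Require Import all_classical all_reals all_analysis.

Set Implicit Arguments.
Unset Strict Implicit.
Unset Printing Implicit Defensive.

Import Order.TTheory GRing.Theory Num.Theory.
Import numFieldNormedType.Exports.

Local Open Scope classical_set_scope.
Local Open Scope ring_scope.

(* The library's norm on 'rV[R]_n is the max norm. It gives the right topology
   and bounded sets, but unit vectors and balls need the Euclidean norm. *)
Definition enorm (R : realType) (n : nat) (x : 'rV[R]_n) : R :=
  Num.sqrt (\sum_i x 0 i ^+ 2).

Definition esphere (R : realType) (n : nat) : set 'rV[R]_n :=
  [set e | enorm e = 1].

Definition eball (R : realType) (n : nat) (z : 'rV[R]_n) (r : R) :
    set 'rV[R]_n := [set x | enorm (x - z) < r].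

Definition boundary (T : topologicalType) (A : set T) : set T :=
  closure A `\` interior A.

Definition uniform_outer_ball (R : realType) (n : nat) (Omega : set 'rV[R]_n) :
    Prop :=
  exists2 rho : R, 0 < rho &
    forall y, boundary Omega y ->
      exists z, eball z rho `<=` ~` Omega /\ boundary (eball z rho) y.

Definition domain (T : topologicalType) (A : set T) : Prop :=
  [/\ open A, connected A & A !=set0].

Definition symmx (R : realType) (n : nat) : set 'M[R]_n := [set X | X^T = X].

(* The order X <= Y on symmetric matrices: Y - X is positive semidefinite. *)
Definition lemx (R : realType) (n : nat) (X Y : 'M[R]_n) : Prop :=
  forall v : 'rV[R]_n, 0 <= (v *m (Y - X) *m v^T) 0 0.

Definition tens (R : realType) (n : nat) (e : 'rV[R]_n) : 'M[R]_n :=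
  e^T *m e.

(* H is a function on R^n x S^n: it is total on 'M[R]_n, but all that is
   assumed about it concerns symmetric matrices only. *)
Definition admissible (R : realType) (n : nat)
    (H : 'rV[R]_n -> 'M[R]_n -> R) : Prop :=
  {within [set q : 'rV[R]_n * 'M[R]_n | symmx q.2],
    continuous (fun q => H q.1 q.2)} /\
  forall p, H p 0 = 0.

Definition condA (R : realType) (n : nat)
    (H : 'rV[R]_n -> 'M[R]_n -> R) : Prop :=
  forall p X Y, symmx X -> symmx Y -> lemx X Y -> H p X <= H p Y.

(* With the library's convention 0 `^ 0 = 1, the case k1 = 0 says that H does
   not depend on p; this is also what the relation for theta != 0 gives, by
   continuity of H. *)
Definition condB (R : realType) (n : nat) (H : 'rV[R]_n -> 'M[R]_n -> R)
    (k1 : R) (k2 : nat) : Prop :=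
  [/\ 0 <= k1, odd k2,
      forall theta p X, symmx X -> H (theta *: p) X = `|theta| `^ k1 * H p X &
      forall theta p X, symmx X -> 0 < theta ->
        H p (theta *: X) = theta ^+ k2 * H p X].

(* Values of H(e, I - s e (x) e) and of H(e, s e (x) e - I) for |e| = 1. *)
Definition valsp (R : realType) (n : nat) (H : 'rV[R]_n -> 'M[R]_n -> R)
    (s : R) : set R :=
  [set H e (1%:M - s *: tens e) | e in @esphere R n].

Definition valsm (R : realType) (n : nat) (H : 'rV[R]_n -> 'M[R]_n -> R)
    (s : R) : set R :=
  [set H e (s *: tens e - 1%:M) | e in @esphere R n].

Definition m1 (R : realType) (n : nat) (H : 'rV[R]_n -> 'M[R]_n -> R)
    (s : R) : R :=
  Num.min (inf (valsp H s)) (- sup (valsm H s)).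

Definition m2 (R : realType) (n : nat) (H : 'rV[R]_n -> 'M[R]_n -> R)
    (s : R) : R :=
  Num.max (sup (valsp H s)) (- inf (valsm H s)).

Lemma enorm_continuous (R : realType) (n : nat) :
  continuous (@enorm R n).
Proof.
move=> x; apply: (@continuous_comp _ _ _ (fun x : 'rV[R]_n => \sum_i x 0 i ^+ 2) Num.sqrt).
  apply: (continuous_big (op := +%R : R -> R -> R)); first exact: add_continuous.
  move=> i _ {}x.
  by apply: (@continuous_comp _ _ _ (fun x : 'rV[R]_n => x 0 i) (fun y : R => y ^+ 2)); [exact: coord_continuous|exact: exprn_continuous].
exact: sqrt_continuous.
Qed.

Lemma esphere_compact (R : realType) (n : nat) : compact (@esphere R n).
Proof.
apply: bounded_closed_compact; last first.
  apply: (closed_comp (f := @enorm R n) (D := [set 1])).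
    by move=> x _; exact: enorm_continuous.
  exact: closed_eq.
exists 1; split => // M M1 x xS; apply: (le_trans _ (ltW M1)).
rewrite [leLHS]mx_normrE; apply/bigmax_leP; split => //= -[i j] _ /=.
rewrite ord1 -[leRHS]xS /enorm -sqrtr_sqr ler_wsqrtr//.
by rewrite (bigD1 j)//= lerDl sumr_ge0// => k _; rewrite sqr_ge0.
Qed.

Lemma esphere_neq0 (R : realType) (n : nat) : (0 < n)%N -> @esphere R n !=set0.
Proof.
case: n => // n _; exists (delta_mx 0 0); rewrite /esphere /enorm /=.
rewrite (bigD1 0)//= big1 => [|i i0]; last by rewrite mxE (negbTE i0) expr0n.
by rewrite mxE !eqxx expr1n addr0 sqrtr1.
Qed.

Lemma mx_continuous (R : realType) (T : topologicalType) (m n : nat)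
  (f : T -> 'M[R]_(m, n)) : (forall i j, continuous (fun x => f x i j)) -> continuous f.
Proof.
move=> cf x; apply/cvg_ballP => e e0.
have : \forall y \near x, forall ij : 'I_m * 'I_n, ball (f x ij.1 ij.2) e (f y ij.1 ij.2).
  by apply: filter_forall => ij; move/cvg_ballP: (cf ij.1 ij.2 x); apply.
by apply: filterS => y fy; split => // i j; exact: (fy (i, j)).
Qed.

Lemma tens_continuous (R : realType) (n : nat) : continuous (@tens R n).
Proof.
apply: mx_continuous => i j x.
have -> : (fun e => @tens R n e i j) = (fun e => e 0 i) \* (fun e => e 0 j).
  by apply/funext => e; rewrite /tens mxE big_ord1 mxE.
by apply: continuousM; exact: coord_continuous.
Qed.

Lemma tens_sym (R : realType) (n : nat) (e : 'rV[R]_n) : symmx (tens e).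
Proof. by rewrite /symmx /tens /= trmx_mul trmxK. Qed.

Lemma sphere_extrema (R : realType) (n : nat) (H : 'rV[R]_n -> 'M[R]_n -> R)
    (M : 'rV[R]_n -> 'M[R]_n) : (0 < n)%N -> admissible H ->
  continuous M -> (forall e, symmx (M e)) ->
  let A := [set H e (M e) | e in @esphere R n] in A (inf A) /\ A (sup A).
Proof.
move=> n0 [cH _] cM sM A.
have cf : continuous (fun e => H e (M e)).
  move=> e.
  have /(_ (e, M e) (sM e)) /= := (subspace_continuousP _ _).1 cH.
  move=> cHe; apply: (cvg_trans _ cHe) => B /= HB.
  have cp : (fun x => (x, M x)) @ e --> (e, M e).
    exact: (cvg_pair (f := id) cvg_id (cM e)).
  exact: (filterS (fun x (Bx : symmx (M x) -> _) => Bx (sM x)) (cp _ HB)).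
have [[c cS cmin] [d dS dmax]] := (@EVT_min_rV _ _ _ _ (esphere_neq0 R n0) (@esphere_compact R n) (continuous_subspaceT cf),
  @EVT_max_rV _ _ _ _ (esphere_neq0 R n0) (@esphere_compact R n) (continuous_subspaceT cf)).
rewrite !inE in cS dS.
have Ac : A (H c (M c)) by exists c.
have Ad : A (H d (M d)) by exists d.
have lb : lbound A (H c (M c)) by move=> _ [e eS <-]; apply: cmin; rewrite inE.
have ub : ubound A (H d (M d)) by move=> _ [e eS <-]; apply: dmax; rewrite inE.
split.
  suff -> : inf A = H c (M c) by [].
  apply/eqP; rewrite eq_le lb_le_inf ?andbT//; last by exists (H c (M c)).
  by apply: ge_inf => //; exists (H c (M c)).
suff -> : sup A = H d (M d) by [].
apply/eqP; rewrite eq_le ge_sup//=; last by exists (H d (M d)).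
by apply: ub_le_sup => //; exists (H d (M d)).
Qed.

(* The infima and suprema in m1 and m2 are attained: they are the minima and
   maxima over |e| = 1. *)
Lemma vals_extrema (R : realType) (n : nat) (H : 'rV[R]_n -> 'M[R]_n -> R)
    (s : R) : (0 < n)%N -> admissible H ->
  [/\ valsp H s (inf (valsp H s)), valsp H s (sup (valsp H s)),
      valsm H s (inf (valsm H s)) & valsm H s (sup (valsm H s))].
Proof.
move=> n0 hH.
have cst : continuous (fun e => s *: @tens R n e).
  by move=> e; exact: (continuous_comp (@tens_continuous R n e) (@scaler_continuous _ _ s _)).
have sst e : symmx (s *: @tens R n e).
  by rewrite /symmx /= linearZ /= tens_sym.
have [| |? ?] := @sphere_extrema _ _ H (fun e => 1%:M - s *: tens e) n0 hH.
- by move=> e; exact: (cvgB (cvg_cst _) (cst e)).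
- by move=> e; rewrite /symmx /= linearB /= sst trmx1.
have [| |? ?] := @sphere_extrema _ _ H (fun e => s *: tens e - 1%:M) n0 hH.
- by move=> e; exact: (cvgB (cst e) (cvg_cst _)).
- by move=> e; rewrite /symmx /= linearB /= sst trmx1.
by [].
Qed.

Definition condC (R : realType) (n : nat) (H : 'rV[R]_n -> 'M[R]_n -> R)
    (k1 : R) (k2 : nat) : Prop :=
  0 < m1 H (k1 / (k1 + k2%:R)) /\
  exists s1 s0 l : R,
    [/\ s1 <= 1, 1 <= s0, 0 < l,
        forall s, s <= s1 -> 0 < m1 H s &
        forall s, s0 <= s -> m2 H s < - l].

Definition case_i (R : realType) (n : nat)
    (H : 'rV[R]_n -> 'M[R]_n -> R) : Prop :=
  exists sbar : R, [/\ 1 < sbar, sbar < 2 & m2 H sbar < 0].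

Definition case_ii (R : realType) (n : nat)
    (H : 'rV[R]_n -> 'M[R]_n -> R) : Prop :=
  exists sbar : R, 2 <= sbar /\ forall s, sbar < s -> m2 H s < 0.

Definition partial (R : realType) (n : nat) (i : 'I_n) (f : 'rV[R]_n -> R) :
    'rV[R]_n -> R := 'D_(delta_mx 0 i) f.

Definition grad (R : realType) (n : nat) (f : 'rV[R]_n -> R)
    (x : 'rV[R]_n) : 'rV[R]_n := \row_i partial i f x.

Definition hess (R : realType) (n : nat) (f : 'rV[R]_n -> R)
    (x : 'rV[R]_n) : 'M[R]_n := \matrix_(i, j) partial i (partial j f) x.

(* U is meant to be open. Continuity of f on U need not be required: it follows
   from that of the partial derivatives. *)
Definition C1_on (R : realType) (n : nat) (U : set 'rV[R]_n)
    (f : 'rV[R]_n -> R) : Prop :=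
  forall i : 'I_n,
    (forall x, U x -> derivable f x (delta_mx 0 i)) /\
    {within U, continuous (partial i f)}.

Definition C2_on (R : realType) (n : nat) (U : set 'rV[R]_n)
    (f : 'rV[R]_n -> R) : Prop :=
  C1_on U f /\ forall i : 'I_n, C1_on U (partial i f).

(* Viscosity solutions of F(x, u, Du, D^2u) = 0 in Omega, with F nondecreasing
   in D^2u: F >= 0 where u - psi has a local maximum and F <= 0 where it has a
   local minimum. *)
Definition viscosity_sub (R : realType) (n : nat) (Omega : set 'rV[R]_n)
    (F : 'rV[R]_n -> R -> 'rV[R]_n -> 'M[R]_n -> R) (u : 'rV[R]_n -> R) : Prop :=
  forall (psi : 'rV[R]_n -> R) y, C2_on Omega psi -> Omega y ->
    (\forall x \near y, u x - psi x <= u y - psi y) ->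
    0 <= F y (u y) (grad psi y) (hess psi y).

Definition viscosity_super (R : realType) (n : nat) (Omega : set 'rV[R]_n)
    (F : 'rV[R]_n -> R -> 'rV[R]_n -> 'M[R]_n -> R) (u : 'rV[R]_n -> R) : Prop :=
  forall (psi : 'rV[R]_n -> R) y, C2_on Omega psi -> Omega y ->
    (\forall x \near y, u y - psi y <= u x - psi x) ->
    F y (u y) (grad psi y) (hess psi y) <= 0.

Definition viscosity_sol (R : realType) (n : nat) (Omega : set 'rV[R]_n)
    (F : 'rV[R]_n -> R -> 'rV[R]_n -> 'M[R]_n -> R) (u : 'rV[R]_n -> R) : Prop :=
  [/\ {within Omega, continuous u}, viscosity_sub Omega F u &
      viscosity_super Omega F u].

(* H(Du, D^2u) + lambda a(x) |u|^(k-1) u = 0 in Omega, u = g on its boundary,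
   with u continuous and positive on the closure. *)
Definition positive_solution (R : realType) (n : nat) (Omega : set 'rV[R]_n)
    (H : 'rV[R]_n -> 'M[R]_n -> R) (k lambda : R) (a g : 'rV[R]_n -> R)
    (u : 'rV[R]_n -> R) : Prop :=
  [/\ {within closure Omega, continuous u},
      forall x, closure Omega x -> 0 < u x,
      viscosity_sol Omega
        (fun x r p X => H p X + lambda * a x * `|r| `^ (k - 1) * r) u &
      forall x, boundary Omega x -> u x = g x].

(* Main.v *)
(* Perron's method without a comparison principle. The candidate v is the
   supremum of the continuous subsolutions w with c0 <= w <= t u and w <= h on
   the boundary, where t delta >= max h and 0 < c0 <= min h.
   - Since m2(s) < 0 for some s > 1, s <> 2, the function |x - z|^(2 - s) /
     (2 - s) is a strict classical supersolution away from z and its opposite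
     a strict subsolution. With z on the boundary (s < 2) or inside an outer
     ball (s > 2) this yields upper and lower barriers at every boundary point,
     so that v = h there and v is continuous at the boundary.
   - Interior continuity comes from Walsh's translation argument: by
     homogeneity, w(. + z) + e multiplied by a constant slightly below 1 is
     again a subsolution for small z, since adding e makes it strict enough to
     absorb the variation of a. Near the boundary it lies below a fixed member
     of the class, so it can be glued to it, whence v(x + z) <= v(x) + o(1).
   - Being continuous, v is a subsolution; the usual bump construction,
     together with the fact that t u is a supersolution, shows that v is a
     supersolution.
   Viscosity inequalities are handled through second-order jets, that is, with
   quadratic polynomials as test functions. *)

(* The zero-order term increases with [u], the sign for which the usual comparison argument breaks
   down. Its substitute is a ceiling: by homogeneity the given [u] may be multiplied by any [t > 0].
   A minimum principle gives [u >= delta] on the whole closure, so [U = t u] dominates [max h]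
   everywhere and not only on the boundary; this is why lower barriers stay below [U] with no
   further adjustment. The same sign also helps: positive constants are subsolutions, and raising a
   subsolution by a constant leaves room to spare. The floor [c0] links the two perturbations used,
   adding [e] and multiplying by a constant: for functions that are at least [c0], an additive error
   is a relative one. Admitting only continuous members avoids semicontinuous envelopes, at the
   price of a direct proof that the supremum is continuous. In the barriers, [s > 1] makes the
   factor that homogeneity extracts from [H] decrease with the distance to the centre, so strictness
   is uniform on bounded sets; [s = 2] would bring in a logarithm. *)
Require Import Defs.
From mathcomp Require Import all_boot all_order all_algebra.
From mathcomp Require Import all_classical all_reals all_analysis.
From mathcomp Require Import ring lra.

Import Order.TTheory GRing.Theory Num.Theory.
Import numFieldNormedType.Exports.

Set Implicit Arguments.
Unset Strict Implicit.
Unset Printing Implicit Defensive.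

Local Open Scope classical_set_scope.
Local Open Scope ring_scope.

(** * Quadratic forms *)

Section Dot.
Variables (R : realType) (n : nat).
Implicit Types (p q d e x y : 'rV[R]_n) (X Y : 'M[R]_n).

Lemma near_shiftP x (P : 'rV[R]_n -> Prop) :
  (\forall y \near x, P y) <->
  exists2 r : R, 0 < r & forall d, `|d| < r -> P (x + d).
Proof.
split=> [/nbhs_normP[r /= r0 rP]|[r r0 rP]].
  by exists r => // d dr; apply: rP; rewrite /= opprD addNKr normrN.
apply/nbhs_normP; exists r => // y /= yr.
by rewrite -(subrK x y) addrC; apply: rP; rewrite distrC.
Qed.

Definition dotv p d : R := (p *m d^T) 0 0.

Lemma dotvE p d : dotv p d = \sum_i p 0 i * d 0 i.
Proof. by rewrite /dotv mxE; apply: eq_bigr => i _; rewrite mxE. Qed.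

Lemma dotvC p d : dotv p d = dotv d p.
Proof. by rewrite !dotvE; apply: eq_bigr => i _; rewrite mulrC. Qed.

Lemma dotvDl p q d : dotv (p + q) d = dotv p d + dotv q d.
Proof. by rewrite /dotv mulmxDl mxE. Qed.

Lemma dotvZl a p d : dotv (a *: p) d = a * dotv p d.
Proof. by rewrite /dotv -scalemxAl mxE. Qed.

Lemma dotvNl p d : dotv (- p) d = - dotv p d.
Proof. by rewrite -scaleN1r dotvZl mulN1r. Qed.

Lemma dotvDr p q d : dotv d (p + q) = dotv d p + dotv d q.
Proof. by rewrite dotvC dotvDl !(dotvC d). Qed.

Lemma dotvZr a p d : dotv d (a *: p) = a * dotv d p.
Proof. by rewrite dotvC dotvZl dotvC. Qed.

Lemma dotvBl p q d : dotv (p - q) d = dotv p d - dotv q d.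
Proof. by rewrite dotvDl dotvNl. Qed.

Lemma dotv0l d : dotv 0 d = 0.
Proof. by rewrite -(scale0r (0 : 'rV_n)) dotvZl mul0r. Qed.

Lemma dotv_sym X d e : symmx X -> dotv (d *m X) e = dotv (e *m X) d.
Proof.
move=> sX; rewrite [RHS]dotvC /dotv trmx_mul [X in d *m (X *m _)]sX.
by rewrite mulmxA.
Qed.

Lemma dotv_ge0 d : 0 <= dotv d d.
Proof. by rewrite dotvE sumr_ge0 // => i _; rewrite -expr2 sqr_ge0. Qed.

Lemma coord_le_norm d i : `|d 0 i| <= `|d|.
Proof.
by have := lexx `|d|; rewrite {1}[`|d|]mx_normrE => /bigmax_leP[_ /(_ (0, i) isT)].
Qed.

Lemma norm_lev d (r : R) : 0 <= r -> (forall i, `|d 0 i| <= r) -> `|d| <= r.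
Proof.
move=> r0 dr; rewrite [leLHS]mx_normrE; apply/bigmax_leP; split => // -[i j] _.
by rewrite ord1; exact: dr.
Qed.

(** The norm is the max norm, hence the factor [n] in place of the Cauchy-Schwarz constant 1. *)
Lemma dotv_norm p d : `|dotv p d| <= n%:R * `|p| * `|d|.
Proof.
rewrite dotvE; apply: (le_trans (ler_norm_sum _ _ _)).
rewrite -mulrA mulr_natl -[X in _ *+ X]card_ord -sumr_const; apply: ler_sum => i _.
by rewrite normrM ler_pM // coord_le_norm.
Qed.

Lemma norm_dotv d : `|d| ^+ 2 <= dotv d d.
Proof.
have := norm_lev (sqrtr_ge0 (dotv d d)) (d := d) _; rewrite -(ler_pXn2r (n := 2)) ?nnegrE ?sqrtr_ge0 //.
rewrite sqr_sqrtr ?dotv_ge0 //; apply => i.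
rewrite -sqrtr_sqr ler_wsqrtr // dotvE (bigD1 i) //= expr2 lerDl sumr_ge0 // => j _.
by rewrite -expr2 sqr_ge0.
Qed.

Lemma dotv_gt0 d : d != 0 -> 0 < dotv d d.
Proof. by rewrite -normr_gt0 => d0; apply: lt_le_trans (norm_dotv d); rewrite exprn_gt0. Qed.

(** A second-order Taylor polynomial without its constant term: [p] is the gradient at 0 and, for
    symmetric [X], [X] is the Hessian. *)
Definition quad p X d : R := dotv p d + dotv (d *m X) d / 2.

Lemma quadN p X d : quad (- p) (- X) d = - quad p X d.
Proof. by rewrite /quad mulmxN !dotvNl mulNr opprD. Qed.

Lemma quadZ a p X d : quad (a *: p) (a *: X) d = a * quad p X d.
Proof. by rewrite /quad -scalemxAr !dotvZl mulrDr mulrA. Qed.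

(** Shifting the Hessian by a multiple of the identity is the device that makes contact strict; the
    2 cancels the 1/2 in [quad]. *)
Lemma quad_scalar p X c d :
  quad p (X + (2 * c)%:M) d = quad p X d + c * dotv d d.
Proof.
rewrite /quad mulmxDr mul_mx_scalar dotvDl dotvZl; by field.
Qed.

Lemma quad0 p X : quad p X 0 = 0.
Proof. by rewrite /quad mul0mx dotv0l dotvC dotv0l mul0r addr0. Qed.

Lemma quad_shift p X d e : symmx X ->
  quad p X (d + e) = quad p X d + quad (p + d *m X) X e.
Proof.
move=> sX; rewrite /quad mulmxDl !(dotvDl, dotvDr) (dotv_sym e d sX).
by field.
Qed.

Lemma symmxD X Y : symmx X -> symmx Y -> symmx (X + Y).
Proof. by rewrite /symmx /= linearD /= => -> ->. Qed.

Lemma symmxZ a X : symmx X -> symmx (a *: X).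
Proof. by rewrite /symmx /= linearZ /= => ->. Qed.

Lemma symmxN X : symmx X -> symmx (- X).
Proof. by rewrite /symmx /= linearN /= => ->. Qed.

Lemma symmx_scalar (a : R) : symmx (a%:M : 'M[R]_n).
Proof. by rewrite /symmx /= tr_scalar_mx. Qed.

(** First- and second-order conditions at a one-dimensional minimum, with a slack [e] in the
    quadratic coefficient. *)
Lemma quadratic_ge0 (a b c : R) :
  (forall e : R, 0 < e -> exists2 r : R, 0 < r & forall t : R, `|t| < r ->
     0 <= t * a + t ^+ 2 * (b + e * c)) -> a = 0 /\ 0 <= b.
Proof.
move=> H; have a0 : a = 0.
  have [r r0 rP] := H 1 ltr01; set B : R := `|b + c| + 1.
  have B0 : 0 < B by rewrite ltr_wpDl.
  apply/eqP/negPn/negP => an0.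
  (* At [t = - sg a * s] the linear term is [- s |a|], while this [s] keeps the quadratic term at
     most [s |a| / 2]. *)
  pose s : R := Num.min (r / 2) (`|a| / (2 * B)).
  have s0 : 0 < s by rewrite lt_min !divr_gt0 ?mulr_gt0 // normr_gt0.
  have sr : s < r by rewrite gt_min; apply/orP; left; lra.
  have sB : s * B <= `|a| / 2.
    have sle : s <= `|a| / (2 * B) by rewrite ge_min lexx orbT.
    rewrite -ler_pdivlMr //.
    by apply: (le_trans sle); rewrite invfM mulrA lexx.
  have := rP (- Num.sg a * s).
  rewrite mulNr normrN normrM normr_sg an0 /= mulr1n !mul1r gtr0_norm // => /(_ sr).
  rewrite sqrrN exprMn sqr_sg an0 /= mulr1n !mul1r mulNr mulrAC -normrEsg.
  have : b + c <= B by rewrite (le_trans (ler_norm _)) // lerDl.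
  have : 0 < `|a| by rewrite normr_gt0.
  nra.
split => //; apply/ler_addgt0Pr => e e0.
have [r r0 rP] := H (e / (`|c| + 1)) (divr_gt0 e0 (ltr_wpDl (normr_ge0 _) ltr01)).
have := rP (r / 2); rewrite gtr0_norm ?divr_gt0 // => /(_ ltac:(lra)).
rewrite a0 mulr0 add0r pmulr_rge0 ?exprn_gt0 ?divr_gt0 // => /le_trans; apply.
rewrite lerD2l mulrAC ler_pdivrMr ?ltr_wpDl // ler_pM2l //.
by rewrite (le_trans (ler_norm _)) // lerDl.
Qed.

(** Restriction to each line through 0 reduces this to [quadratic_ge0]. The slack [e] admits
    functions known only through a second-order expansion. *)
Lemma quad_touch p q X Y :
  (forall e : R, 0 < e -> \forall d \near (0 : 'rV[R]_n),
     quad p X d - e * dotv d d <= quad q Y d) -> p = q /\ lemx X Y.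
Proof.
move=> H; have key v : dotv (q - p) v = 0 /\ 0 <= dotv (v *m (Y - X)) v / 2.
  apply: (@quadratic_ge0 _ _ (dotv v v)) => e e0.
  have /near_shiftP[r r0 rP] := H e e0.
  exists (r / (`|v| + 1)); first by rewrite divr_gt0 // ltr_wpDl.
  move=> t; rewrite ltr_pdivlMr ?ltr_wpDl // => tr.
  have := rP (t *: v); rewrite normrZ add0r.
  have -> : (`|t| * `|v| < r)%R.
    by apply: le_lt_trans tr; rewrite ler_wpM2l // lerDl.
  move/(_ isT); rewrite /quad -!scalemxAl !(dotvZl, dotvZr) -subr_ge0.
  congr (_ <= _); rewrite dotvBl mulmxBr dotvBl; by field.
split; last first.
  by move=> v; have [_] := key v; rewrite pmulr_lge0 // invr_gt0.
apply/esym/eqP; rewrite -subr_eq0; apply/eqP.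
apply/eqP; apply: contraT => /dotv_gt0; have [-> _] := key (q - p).
by rewrite ltxx.
Qed.

End Dot.

(** The difference quotient is exactly [b + h c], so derivatives of polynomials need no
    differentiation rules. *)
Lemma is_derive_quadratic (R : realType) (V : normedModType R) (f : V -> R)
    (a v : V) (b c : R) :
  (forall h, f (h *: v + a) = f a + h * b + h ^+ 2 * c) -> is_derive a v f b.
Proof.
move=> fE; have H : (fun h => h^-1 *: (f (h *: v + a) - f a)) @ 0^' --> b.
  have : (fun h : R => b + h * c) @ 0^' --> b.
    rewrite -[X in _ --> X]addr0 -[X in b + X](mul0r c).
    apply: cvgD; first exact: cvg_cst.
    by apply: cvgM; [exact: nbhs_dnbhs | exact: cvg_cst].
  apply: cvg_trans; apply: near_eq_cvg; near=> h.
  have h0 : h != 0 by near: h; exact: nbhs_dnbhs_neq.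
  have -> : f (h *: v + a) - f a = h * (b + h * c) by rewrite fE; ring.
  by rewrite /GRing.scale /= mulKf.
split; first by apply/cvg_ex; exists b.
exact: cvg_lim.
Unshelve. all: by end_near. Qed.

(** * Second-order Taylor expansion *)

Lemma is_derive_line (R : realType) (V : normedModType R) (f : V -> R)
    (a v : V) (t b : R) :
  is_derive (t *: v + a) v f b ->
  is_derive t (1 : R) (fun s : R => f (s *: v + a)) b.
Proof.
move=> [df Df].
have E : (fun h : R => h^-1 *: (f ((h *: (1 : R) + t) *: v + a) - f (t *: v + a)))
       = (fun h : R => h^-1 *: (f (h *: v + (t *: v + a)) - f (t *: v + a))).
  by apply/funext => h; rewrite [h *: 1]mulr1 scalerDl addrA.
split; first by rewrite /derivable E.
by rewrite -Df /derive E.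
Qed.

Lemma mean_value_bound (R : realType) (g dg : R -> R) (s A C : R) :
  (forall t : R, `|t| <= `|s| -> is_derive t (1 : R) g (dg t) /\ `|dg t - A| <= C) ->
  `|g s - g 0 - A * s| <= C * `|s|.
Proof.
move=> H.
have key (a b : R) : a <= b -> (forall t : R, a <= t <= b -> `|t| <= `|s|) ->
    exists2 c : R, `|c| <= `|s| & g b - g a = dg c * (b - a).
  move=> ab abs.
  have dg' t : t \in `[a, b] -> is_derive t (1 : R) g (dg t).
    by rewrite in_itv /= => /abs /H[].
  have dgo t : t \in `]a, b[ -> is_derive t (1 : R) g (dg t).
    by rewrite in_itv /= => /andP[at_ tb]; apply: dg'; rewrite in_itv /= !ltW.
  have cg : {within `[a, b], continuous g}.
    by apply: derivable_within_continuous => t /dg' [].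
  have [c] := MVT_segment ab dgo cg.
  by rewrite in_itv /= => /abs cs gE; exists c.
have [s0|s0] := leP 0 s.
  have [|c cs ->] := key 0 s s0.
    by move=> t /andP[t0 ts]; rewrite !ger0_norm // (le_trans t0).
  by rewrite subr0 -mulrBl normrM ler_wpM2r //; have [] := H c cs.
have [|c cs gE] := key s 0 (ltW s0).
  move=> t /andP[st t0]; rewrite ler0_norm // ler0_norm ?lerN2 //; exact: ltW.
have -> : g s - g 0 - A * s = (dg c - A) * s by lra.
by rewrite normrM ler_wpM2r //; have [] := H c cs.
Qed.

Section Taylor.
Variables (R : realType) (n : nat).
Implicit Types (p q d x y : 'rV[R]_n) (X : 'M[R]_n) (i j : 'I_n).

Lemma dotv_delta p i : dotv p (delta_mx 0 i) = p 0 i.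
Proof.
rewrite dotvE (bigD1 i) //= big1 => [|j ji].
  by rewrite mxE !eqxx mulr1 addr0.
by rewrite mxE (negbTE ji) andbF mulr0.
Qed.

Lemma norm_delta_le i : `|delta_mx 0 i : 'rV[R]_n| <= 1.
Proof. by apply: norm_lev => // j; rewrite mxE normr_nat; case: (_ && _); rewrite ?ler01 ?lexx. Qed.

Lemma is_derive_quad (c : R) p X y x i : symmx X ->
  is_derive x (delta_mx 0 i) (fun x => c + quad p X (x - y))
    ((p + (x - y) *m X) 0 i).
Proof.
move=> sX.
apply: (@is_derive_quadratic _ _ _ _ _ _ (dotv (delta_mx 0 i *m X) (delta_mx 0 i) / 2)) => h.
have -> : h *: delta_mx 0 i + x - y = (x - y) + h *: delta_mx 0 i.
  by rewrite -addrA addrC.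
rewrite quad_shift // [quad (p + _) _ _]/quad -scalemxAl !(dotvZl, dotvZr, dotv_delta).
by ring.
Qed.

Lemma partial_quad (c : R) p X y i : symmx X ->
  partial i (fun x => c + quad p X (x - y)) = (fun x => (p + (x - y) *m X) 0 i).
Proof. by move=> sX; apply/funext => x; have [] := is_derive_quad c p y x i sX. Qed.

Lemma is_derive_affine p X y x i j :
  is_derive x (delta_mx 0 i) (fun x => (p + (x - y) *m X) 0 j) (X i j).
Proof.
apply: (@is_derive_quadratic _ _ _ _ _ _ 0) => h.
have -> : h *: delta_mx 0 i + x - y = (x - y) + h *: delta_mx 0 i.
  by rewrite -addrA addrC.
rewrite mulmxDl -scalemxAl !mxE mulr0 addr0 addrA; congr (_ + _ * _).
rewrite (bigD1 i) //= big1 => [|k ki].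
  by rewrite mxE !eqxx mul1r addr0.
by rewrite mxE (negbTE ki) andbF mul0r.
Qed.

Lemma partial_affine p X y i j :
  partial i (fun x => (p + (x - y) *m X) 0 j) = cst (X i j).
Proof. by apply/funext => x; have [] := is_derive_affine p X y x i j. Qed.

Lemma affine_continuous p X y j :
  continuous (fun x => (p + (x - y) *m X) 0 j).
Proof.
have -> : (fun x => (p + (x - y) *m X) 0 j)
        = (fun x => (p - y *m X) 0 j + \sum_k x 0 k * X k j).
  by apply/funext => x; rewrite mulmxBl !mxE; ring.
have cs : continuous (fun x : 'rV[R]_n => \sum_k x 0 k * X k j).
  apply: (continuous_big (op := +%R : R -> R -> R)); first exact: add_continuous.
  move=> k _ z; exact: (cvgM (@coord_continuous _ _ _ 0 k z) (cvg_cst _)).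
by move=> x; exact: (cvgD (cvg_cst _) (cs x)).
Qed.

Lemma quad_C2 (U : set 'rV[R]_n) (c : R) p X y : symmx X ->
  C2_on U (fun x => c + quad p X (x - y)).
Proof.
move=> sX; split=> [i|i].
  split=> [x _|]; first by have [] := is_derive_quad c p y x i sX.
  by rewrite partial_quad //; apply: continuous_subspaceT; exact: affine_continuous.
rewrite partial_quad // => j; split=> [x _|].
  by have [] := is_derive_affine p X y x j i.
by rewrite partial_affine; apply: continuous_subspaceT; exact: cst_continuous.
Qed.

Lemma grad_quad (c : R) p X y : symmx X ->
  grad (fun x => c + quad p X (x - y)) y = p.
Proof.
move=> sX; apply/rowP => i.
by rewrite mxE partial_quad // subrr mul0mx addr0.
Qed.

Lemma hess_quad (c : R) p X y : symmx X ->
  hess (fun x => c + quad p X (x - y)) y = X.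
Proof.
by move=> sX; apply/matrixP => i j; rewrite mxE partial_quad // partial_affine.
Qed.

(** Only partial derivatives are given, so the increment is split along a staircase that changes one
    coordinate at a time; in the max norm it never leaves the ball. *)
Lemma mean_value_ineq (f : 'rV[R]_n -> R) (D : 'I_n -> 'rV[R]_n -> R) y p (r C : R) :
  (forall i x, `|x - y| < r ->
     is_derive x (delta_mx 0 i) f (D i x) /\ `|D i x - p 0 i| <= C) ->
  forall d, `|d| < r -> `|f (y + d) - f y - dotv p d| <= n%:R * C * `|d|.
Proof.
move=> H d dr.
pose dk (k : nat) : 'rV[R]_n := \row_i (if (i < k)%N then d 0 i else 0).
have dk_le k : `|dk k| <= `|d|.
  apply: norm_lev => // i; rewrite mxE; case: ifP => _; first exact: coord_le_norm.
  by rewrite normr0.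
have -> : f (y + d) - f y = \sum_(0 <= k < n) (f (y + dk k.+1) - f (y + dk k)).
  rewrite telescope_sumr //; congr (f _ - f _).
    by congr (_ + _); apply/rowP => i; rewrite mxE ltn_ord.
  by rewrite (_ : dk 0%N = 0) ?addr0 //; apply/rowP => i; rewrite !mxE.
rewrite big_mkord dotvE -sumrB -mulrA mulr_natl -[X in _ *+ X]card_ord -sumr_const.
apply: (le_trans (ler_norm_sum _ _ _)); apply: ler_sum => k _.
have dkS : dk k.+1 = d 0 k *: delta_mx 0 k + dk k.
  apply/rowP => i; rewrite !mxE eqxx /= ltnS leq_eqVlt -(inj_eq val_inj).
  by case: eqP => [/val_inj ->|_] /=; rewrite ?ltnn ?mulr1 ?addr0 // mulr0 add0r.
have C0 : 0 <= C.
  have [|_] := H k y; first by rewrite subrr normr0 (le_lt_trans _ dr).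
  exact: le_trans.
have := @mean_value_bound R (fun t => f (t *: delta_mx 0 k + (y + dk k)))
  (fun t => D k (t *: delta_mx 0 k + (y + dk k))) (d 0 k) (p 0 k) C.
rewrite scale0r add0r addrCA -dkS => /(_ _)/le_trans; apply; last first.
  by rewrite ler_wpM2l // coord_le_norm.
move=> t tk; have [|Dk HC] := H k (t *: delta_mx 0 k + (y + dk k)).
  rewrite addrCA addrAC subrr add0r; apply: le_lt_trans dr; apply: norm_lev => // i.
  rewrite !mxE eqxx /=; case: (eqVneq i k) => [->|ik].
    by rewrite ltnn mulr1 addr0 (le_trans tk) // coord_le_norm.
  rewrite mulr0 add0r; case: ifP => _; first exact: coord_le_norm.
  by rewrite normr0.
by split => //; exact: is_derive_line.
Qed.

End Taylor.

Section C2.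
Variables (R : realType) (n : nat).
Implicit Types (p q d x y : 'rV[R]_n) (X : 'M[R]_n) (i j : 'I_n).

Lemma C1_near (U : set 'rV[R]_n) f y (e : R) : open U -> U y -> C1_on U f ->
  0 < e -> exists2 r : R, 0 < r & forall i x, `|x - y| < r ->
    derivable f x (delta_mx 0 i) /\ `|partial i f x - partial i f y| <= e.
Proof.
move=> oU Uy fC e0.
have : \forall x \near y, forall i,
    derivable f x (delta_mx 0 i) /\ `|partial i f x - partial i f y| <= e.
  apply: (@filter_forall _ _ (fun i x => derivable f x (delta_mx 0 i) /\
    `|partial i f x - partial i f y| <= e) _ (nbhs_filter y)) => i; have [df] := fC i.
  rewrite continuous_open_subspace // => /(_ y (mem_set Uy)) /cvgrPdist_le /(_ e e0) cf.
  near=> x; split.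
    by apply: df; near: x; exact: open_nbhs_nbhs.
  by rewrite distrC; near: x.
move=> /near_shiftP[r r0 rP]; exists r => // i x xr.
by have := rP _ xr; rewrite addrC subrK.
Unshelve. all: by end_near. Qed.

Lemma C1_expand (U : set 'rV[R]_n) f y (e : R) : open U -> U y -> C1_on U f ->
  0 < e -> exists2 r : R, 0 < r & forall d, `|d| < r ->
    `|f (y + d) - f y - dotv (grad f y) d| <= e * `|d|.
Proof.
(* Dividing by [n.+1] absorbs the factor [n] of [mean_value_ineq] and is harmless for [n = 0]. *)
move=> oU Uy fC e0; have e1 : 0 < e / n.+1%:R by rewrite divr_gt0.
have [r r0 rP] := C1_near oU Uy fC e1; exists r => // d dr.
apply: (le_trans (mean_value_ineq (D := fun i => partial i f) (p := grad f y)
  (C := e / n.+1%:R) _ dr)).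
  move=> i x /(rP i)[dfx Hx]; split; last by rewrite mxE.
  exact/derivableP.
rewrite ler_wpM2r // mulrA ler_pdivrMr // mulrC ler_pM2l // ler_nat //.
Qed.

(** The mean value bound is applied in direction [i] to the difference in direction [j]. The 3 adds
    up the expansion errors at two points, at distances at most [2 s] and [s] from [y]. *)
Lemma mixed_difference (f : 'rV[R]_n -> R) y i j p (r e s m : R) :
  p 0 j = m -> 0 < e -> 0 < s -> 2 * s < r ->
  (forall x, `|x - y| < r -> derivable f x (delta_mx 0 i)) ->
  (forall d, `|d| < r ->
    `|partial i f (y + d) - partial i f y - dotv p d| <= e * `|d|) ->
  `|f (y + s *: delta_mx 0 i + s *: delta_mx 0 j) - f (y + s *: delta_mx 0 i)
    - f (y + s *: delta_mx 0 j) + f y - s ^+ 2 * m| <= 3 * e * s ^+ 2.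
Proof.
move=> <- e0 s0 sr df fe.
pose di : 'rV[R]_n := delta_mx 0 i; pose dj : 'rV[R]_n := delta_mx 0 j.
have ndi : `|di| <= 1 by exact: norm_delta_le.
have ndj : `|dj| <= 1 by exact: norm_delta_le.
have H1 (t : R) : `|t| <= `|s| -> `|s *: dj + t *: di| <= 2 * s.
  rewrite (gtr0_norm s0) => ts; apply: (le_trans (ler_normD _ _)).
  have Hs : s * `|dj| <= s by rewrite ler_piMr // ltW.
  have Ht : `|t| * `|di| <= `|t| by rewrite ler_piMr.
  by rewrite !normrZ (gtr0_norm s0); lra.
have H2 (t : R) : `|t| <= `|s| -> `|t *: di| <= s.
  have Ht : `|t| * `|di| <= `|t| by rewrite ler_piMr.
  by rewrite (gtr0_norm s0) => ts; rewrite normrZ (le_trans Ht).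
have := @mean_value_bound R
  (fun t => f (t *: di + (y + s *: dj)) - f (t *: di + y))
  (fun t => partial i f (t *: di + (y + s *: dj)) - partial i f (t *: di + y))
  s (s * p 0 j) (3 * e * s).
rewrite !scale0r !add0r (gtr0_norm s0).
have -> : s *: di + (y + s *: dj) = y + s *: di + s *: dj by rewrite addrA (addrC y).
rewrite (addrC _ y) => H.
have -> : 3 * e * s ^+ 2 = 3 * e * s * s by ring.
set A := f _ in H *; set B := f _ in H *; set C := f _ in H *.
have -> : A - B - C + f y - s ^+ 2 * p 0 j = A - B - (C - f y) - s * p 0 j * s by ring.
apply: H => t ts; have ts' : `|t| <= `|s| by rewrite (gtr0_norm s0).
have E1 : t *: di + (y + s *: dj) = y + (s *: dj + t *: di) by rewrite addrCA (addrC (t *: _)).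
have E2 : t *: di + y = y + t *: di by rewrite addrC.
have b1 : `|s *: dj + t *: di| < r by apply: le_lt_trans sr; exact: H1.
have b2 : `|t *: di| < r by apply: le_lt_trans (H2 t ts') _; lra.
split.
  apply: is_deriveB; apply: is_derive_line; apply/derivableP; apply: df.
    by rewrite E1 (addrC y) addrK.
  by rewrite E2 (addrC y) addrK.
rewrite E1 E2; have := fe _ b1; have := fe _ b2.
rewrite dotvDr !dotvZr !dotv_delta.
have := H1 t ts'; have := H2 t ts'; rewrite !ler_norml.
set P := partial _ _ _; set Q := partial _ _ _; set T := partial _ _ _.
move=> h1 h2 /andP[? ?] /andP[? ?]; apply/andP; split; nra.
Qed.

Lemma le0_eps (a : R) : (forall e : R, 0 < e -> a <= e) -> a <= 0.
Proof.
move=> H; rewrite leNgt; apply/negP => a0.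
by have := H (a / 2) ltac:(lra); lra.
Qed.

Lemma mixed_real (A A' B C D G K s e : R) : 0 < s -> A = A' ->
  `|A - B - C + D - s * K| <= 3 * (e / 6) * s ->
  `|A' - C - B + D - s * G| <= 3 * (e / 6) * s -> `|G - K| <= e.
Proof.
move=> s0 <-; rewrite !ler_norml => /andP[a1 a2] /andP[a3 a4].
have Z : - (s * e) <= s * (G - K) <= s * e by apply/andP; split; lra.
by case/andP: Z => ? ?; apply/andP; split; rewrite -(ler_pM2l s0); lra.
Qed.

(** The second difference is symmetric in [i] and [j] and approximates both mixed derivatives.
    Symmetry matters because the hypotheses on [H] concern symmetric matrices only. *)
Lemma schwarz (U : set 'rV[R]_n) f y : open U -> U y -> C2_on U f ->
  symmx (hess f y).
Proof.
move=> oU Uy [fC fC2]; apply/matrixP => i j; rewrite !mxE.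
suff H (e : R) : 0 < e ->
    `|partial j (partial i f) y - partial i (partial j f) y| <= e.
  apply/eqP; rewrite -subr_eq0 -normr_le0.
  exact: le0_eps.
move=> e0.
(* Each of the two mixed differences has relative error [3 * (e / 6)], that is, [e / 2]. *)
have e6 : 0 < e / 6 by lra.
have [r1 r10 r1P] := C1_near oU Uy fC ltr01.
have [ri ri0 riP] := C1_expand oU Uy (fC2 i) e6.
have [rj rj0 rjP] := C1_expand oU Uy (fC2 j) e6.
pose r : R := Num.min r1 (Num.min ri rj).
have [? ? ?] : [/\ r <= r1, r <= ri & r <= rj].
  by rewrite /r !ge_min !lexx !orbT.
have r0 : 0 < r by rewrite !lt_min r10 ri0.
clearbody r; have s0 : 0 < r / 4 by lra.
have sr : 2 * (r / 4) < r by lra.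
have gE k l : grad (partial k f) y 0 l = partial l (partial k f) y by rewrite mxE.
have df k x : `|x - y| < r -> derivable f x (delta_mx 0 k).
  by move=> xr; have [|//] := r1P k x; exact: lt_le_trans xr _.
have fi d : `|d| < r -> `|partial i f (y + d) - partial i f y -
    dotv (grad (partial i f) y) d| <= e / 6 * `|d|.
  by move=> dr; apply: riP; exact: lt_le_trans dr _.
have fj d : `|d| < r -> `|partial j f (y + d) - partial j f y -
    dotv (grad (partial j f) y) d| <= e / 6 * `|d|.
  by move=> dr; apply: rjP; exact: lt_le_trans dr _.
have Hj := mixed_difference (gE j i) e6 s0 sr (df j) fj.
have Hi := mixed_difference (gE i j) e6 s0 sr (df i) fi.
have s20 : 0 < (r / 4) ^+ 2 by rewrite exprn_gt0.
refine (mixed_real s20 _ Hj Hi).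
by rewrite addrAC.
Qed.

(** The first derivatives of [f] minus its Taylor polynomial are small relative to the distance from
    [y], so [mean_value_ineq] applied to this difference gives a quadratic error. *)
Lemma taylor2 (U : set 'rV[R]_n) f y (e : R) : open U -> U y -> C2_on U f ->
  0 < e -> \forall d \near (0 : 'rV[R]_n),
    `|f (y + d) - f y - quad (grad f y) (hess f y) d| <= e * dotv d d.
Proof.
move=> oU Uy fC2 e0; have sX := schwarz oU Uy fC2; case: fC2 => fC fC2.
have e1 : 0 < e / n.+1%:R by rewrite divr_gt0.
have [r0 r00 r0P] := C1_near oU Uy fC ltr01.
have : \forall d \near (0 : 'rV[R]_n), forall i,
  `|partial i f (y + d) - partial i f y - dotv (grad (partial i f) y) d|
    <= e / n.+1%:R * `|d|.
  apply: (@filter_forall _ _ (fun i d => `|partial i f (y + d) - partial i f y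
    - dotv (grad (partial i f) y) d| <= e / n.+1%:R * `|d|) _ (nbhs_filter _)) => i.
  have [r rp rP] := C1_expand oU Uy (fC2 i) e1.
  by apply/near_shiftP; exists r => // d; rewrite add0r; exact: rP.
move=> /near_shiftP[r1 r10 r1P].
apply/near_shiftP; exists (Num.min r0 r1); first by rewrite lt_min r00.
move=> d; rewrite add0r lt_min => /andP[dr0 dr1].
pose D i x := partial i f x - (grad f y + (x - y) *m hess f y) 0 i.
pose F x := f x - (f y + quad (grad f y) (hess f y) (x - y)).
have d0 := normr_ge0 d.
(* [mean_value_ineq] requires a radius strictly larger than [|d|]; the radius is brought down to
   [|d|] afterwards. *)
have step (t : R) : `|d| < t -> t <= Num.min r0 r1 ->
    `|f (y + d) - f y - quad (grad f y) (hess f y) d|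
      <= n%:R * (e / n.+1%:R * t) * `|d|.
  move=> dt; rewrite le_min => /andP[t0 t1].
  have := @mean_value_ineq _ _ F D y 0 t (e / n.+1%:R * t) _ d dt.
  rewrite dotv0l subr0 /F subrr quad0 addr0 subrr subr0 (addrC y) addrK opprD addrA.
  apply=> i x xt; split.
    apply: is_deriveB; last exact: is_derive_quad.
    by apply/derivableP; have [] := r0P i x (lt_le_trans xt t0).
  rewrite mxE subr0 /D; have := r1P (x - y) (lt_le_trans xt t1) i.
  rewrite add0r (addrC y) subrK => H.
  have -> : partial i f x - (grad f y + (x - y) *m hess f y) 0 i =
     partial i f x - partial i f y - dotv (grad (partial i f) y) (x - y).
    rewrite !mxE opprD addrA; congr (_ - _); rewrite dotvE; apply: eq_bigr => k _.
    by rewrite !mxE mulrC.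
  by apply: (le_trans H); rewrite ler_wpM2l ?ltW.
have m0 : `|d| < Num.min r0 r1 by rewrite lt_min dr0.
apply: le_trans (ler_wpM2l (ltW e0) (norm_dotv d)).
apply/ler_addgt0Pr => t t0.
pose s : R := Num.min (Num.min r0 r1) (`|d| + t / (e * (`|d| + 1))).
have ed : 0 < e * (`|d| + 1) by rewrite mulr_gt0 // ltr_wpDl.
have ds : `|d| < s by rewrite lt_min m0 /= ltrDl divr_gt0.
have ss : s <= Num.min r0 r1 by rewrite ge_min lexx.
have sd : s <= `|d| + t / (e * (`|d| + 1)) by rewrite ge_min lexx orbT.
apply: (le_trans (step s ds ss)).
have nn : n%:R * (e / n.+1%:R) <= e.
  by rewrite mulrA ler_pdivrMr // mulrC ler_pM2l // ler_nat.
have s0 : 0 <= s * `|d| by rewrite mulr_ge0 // (le_trans d0) // ltW.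
apply: (@le_trans _ _ (e * (s * `|d|))).
  by rewrite mulrA -[leLHS]mulrA ler_wpM2r.
have : e * (s * `|d|) <= e * ((`|d| + t / (e * (`|d| + 1))) * `|d|).
  by rewrite ler_pM2l // ler_wpM2r.
move=> /le_trans; apply; rewrite expr2 mulrDl mulrDr lerD2l.
have -> : e * (t / (e * (`|d| + 1)) * `|d|) = t * (`|d| / (`|d| + 1)).
  by field; rewrite !gt_eqF // ltr_wpDl.
by rewrite ler_piMr ?(ltW t0) // ler_pdivrMr ?ltr_wpDl // mul1r lerDl.
Qed.

End C2.

(** * Viscosity solutions and jets *)

Section Jets.
Variables (R : realType) (n : nat).
Implicit Types (p q d x y : 'rV[R]_n) (X Y : 'M[R]_n) (f u : 'rV[R]_n -> R).

(** Exact contact rather than contact up to [o(|d|^2)]; a small multiple of the identity added to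
    [X] bridges the difference. *)
Definition jet_above f y p X : Prop :=
  \forall d \near (0 : 'rV[R]_n), f (y + d) <= f y + quad p X d.

Definition jet_below f y p X : Prop :=
  \forall d \near (0 : 'rV[R]_n), f y + quad p X d <= f (y + d).

Lemma near0P (P : 'rV[R]_n -> Prop) : (\forall d \near (0 : 'rV[R]_n), P d) <->
  exists2 r : R, 0 < r & forall d, `|d| < r -> P d.
Proof.
split=> [/near_shiftP[r r0 rP]|[r r0 rP]].
  by exists r => // d /rP; rewrite add0r.
by apply/near_shiftP; exists r => // d; rewrite add0r; exact: rP.
Qed.

Lemma near_distP x (P : 'rV[R]_n -> Prop) : (\forall y \near x, P y) <->
  exists2 r : R, 0 < r & forall y, `|y - x| < r -> P y.
Proof.
split=> [/near_shiftP[r r0 rP]|[r r0 rP]].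
  by exists r => // y /rP; rewrite addrC subrK.
by apply/near_shiftP; exists r => // d dr; apply: rP; rewrite addrC addKr.
Qed.

Lemma near_shift0 x (P : 'rV[R]_n -> Prop) :
  (\forall y \near x, P y) <-> (\forall d \near (0 : 'rV[R]_n), P (x + d)).
Proof. by rewrite near_shiftP near0P. Qed.

Lemma norm_scalar_mx_le (a : R) : `|a%:M : 'M[R]_n| <= `|a|.
Proof.
rewrite [leLHS]mx_normrE; apply/bigmax_leP; split => // -[i j] _ /=.
by rewrite mxE; case: (i == j); rewrite ?mulr1n // mulr0n normr0.
Qed.

Variable H : 'rV[R]_n -> 'M[R]_n -> R.
Hypothesis Hadm : admissible H.

Lemma operator_continuous p X (e : R) : symmx X -> 0 < e ->
  exists2 r : R, 0 < r & forall q Y, symmx Y -> `|q - p| < r -> `|Y - X| < r ->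
    `|H q Y - H p X| <= e.
Proof.
move=> sX e0; have [cH _] := Hadm.
have /(_ (p, X) sX) := (subspace_continuousP _ _).1 cH.
move=> /cvgrPdist_le/(_ e e0); rewrite near_withinE => /nbhs_ballP[r /= r0 rP].
exists r => // q Y sY qr Yr; rewrite distrC; apply: (rP (q, Y)) => //.
by split; rewrite -ball_normE /= distrC.
Qed.

Lemma viscosity_super_jet (U : set 'rV[R]_n) F u y p X :
  viscosity_super U F u -> U y -> symmx X -> jet_below u y p X ->
  F y (u y) p X <= 0.
Proof.
move=> uF Uy sX uX; have := uF (fun x => u y + quad p X (x - y)) y.
rewrite grad_quad // hess_quad //; apply => //; first exact: quad_C2.
apply/near_shift0; apply: filterS uX => d.
by rewrite (addrC y d) addrK subrr quad0; lra.
Qed.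

(** Adding a small multiple of the identity to [X] turns approximate contact into exact contact, and
    by continuity of [H] this costs at most half of the assumed deficit. *)
Lemma jet_above_limit u y p X (r : R) : symmx X ->
  (forall Y, symmx Y -> jet_above u y p Y -> 0 <= H p Y + r) ->
  (forall e : R, 0 < e -> \forall d \near (0 : 'rV[R]_n),
    u (y + d) <= u y + quad p X d + e * dotv d d) ->
  0 <= H p X + r.
Proof.
move=> sX uJ ule; rewrite leNgt; apply/negP => Fneg.
set c : R := - (H p X + r).
have c0 : 0 < c by rewrite oppr_gt0.
have c2 : 0 < c / 2 by rewrite divr_gt0.
have [s s0 sP] := operator_continuous p sX c2.
have s4 : 0 < s / 4 by rewrite divr_gt0.
set Y := X + (2 * (s / 4))%:M.
have sY : symmx Y by apply: symmxD => //; exact: symmx_scalar.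
have J : jet_above u y p Y.
  by apply: filterS (ule _ s4) => d; rewrite quad_scalar; lra.
have := uJ Y sY J.
have YX : `|Y - X| < s.
  rewrite /Y addrAC subrr add0r; apply: (le_lt_trans (norm_scalar_mx_le _)).
  by rewrite gtr0_norm; lra.
have := sP p Y sY _ YX; rewrite subrr normr0 => /(_ s0).
by rewrite ler_norml => /andP[? ?]; move: (erefl c); rewrite {2}/c; lra.
Qed.

Lemma viscosity_sub_of_jets (U : set 'rV[R]_n) (g : 'rV[R]_n -> R -> R) u :
  open U ->
  (forall y p X, U y -> symmx X -> jet_above u y p X -> 0 <= H p X + g y (u y)) ->
  viscosity_sub U (fun x r p X => H p X + g x r) u.
Proof.
move=> oU uJ psi y psiC Uy umax; have sX := schwarz oU Uy psiC.
apply: (jet_above_limit (u := u) (y := y)) => // [Y sY|e e0]; first exact: uJ.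
have /near_shift0 um := umax.
apply: filterS2 um (taylor2 oU Uy psiC e0) => d.
by rewrite ler_norml => ? /andP[? ?]; lra.
Qed.

Lemma viscosity_super_of_jets (U : set 'rV[R]_n) (g : 'rV[R]_n -> R -> R) u :
  open U ->
  (forall y p X, U y -> symmx X -> jet_below u y p X -> H p X + g y (u y) <= 0) ->
  viscosity_super U (fun x r p X => H p X + g x r) u.
Proof.
move=> oU uJ psi y psiC Uy umin; rewrite leNgt; apply/negP => Fpos.
have sX := schwarz oU Uy psiC.
set c : R := H (grad psi y) (hess psi y) + g y (u y).
have c0 : 0 < c by [].
have c2 : 0 < c / 2 by rewrite divr_gt0.
have [r r0 rP] := operator_continuous (grad psi y) sX c2.
have r4 : 0 < r / 4 by rewrite divr_gt0.
set Y := hess psi y + (2 * (- (r / 4)))%:M.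
have sY : symmx Y by apply: symmxD => //; exact: symmx_scalar.
have J : jet_below u y (grad psi y) Y.
  have /near_shift0 um := umin.
  apply: filterS2 um (taylor2 oU Uy psiC r4) => d.
  by rewrite quad_scalar ler_norml => ? /andP[? ?]; lra.
have := uJ y (grad psi y) Y Uy sY J.
have YX : `|Y - hess psi y| < r.
  rewrite /Y addrAC subrr add0r; apply: (le_lt_trans (norm_scalar_mx_le _)).
  by rewrite ltr0_norm; lra.
have := rP (grad psi y) Y sY _ YX; rewrite subrr normr0 => /(_ r0).
by rewrite ler_norml => /andP[? ?]; move: (erefl c); rewrite {2}/c; lra.
Qed.

End Jets.

(** * Continuity relative to a set *)

Section ContinuousOn.
Variables (R : realType) (n : nat).
Implicit Types (A : set 'rV[R]_n) (f g : 'rV[R]_n -> R) (x y : 'rV[R]_n).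

Definition cont_on A f : Prop := forall x, A x -> forall e : R, 0 < e ->
  \forall y \near x, A y -> `|f y - f x| <= e.

Lemma cont_onP A f : {within A, continuous f} <-> cont_on A f.
Proof.
split=> [/(subspace_continuousP _ _).1 fA x Ax e e0|fA].
  have := fA x Ax => /cvgrPdist_le/(_ e e0); rewrite near_withinE.
  by apply: filterS => y + Ay => /(_ Ay); rewrite distrC.
apply/subspace_continuousP => x Ax; apply/cvgrPdist_le => e e0.
rewrite near_withinE; apply: filterS (fA x Ax e e0) => y + Ay => /(_ Ay).
by rewrite distrC.
Qed.

Lemma cont_on_cst A (c : R) : cont_on A (cst c).
Proof. by move=> x _ e e0; near=> y => _ /=; rewrite subrr normr0 ltW.
Unshelve. all: by end_near. Qed.

Lemma normB_max_le (a b c d e : R) : `|a - c| <= e -> `|b - d| <= e ->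
  `|Num.max a b - Num.max c d| <= e.
Proof.
rewrite !ler_norml => /andP[? ?] /andP[? ?].
by case: (leP a b) => ?; case: (leP c d) => ?; apply/andP; split; lra.
Qed.

Lemma cont_on_max A f g : cont_on A f -> cont_on A g ->
  cont_on A (fun x => Num.max (f x) (g x)).
Proof.
move=> cf cg x Ax e e0; apply: filterS2 (cf x Ax e e0) (cg x Ax e e0) => y fy gy Ay.
by apply: normB_max_le; [exact: fy | exact: gy].
Qed.

(** Heine-Cantor, from the near-covering form of compactness along the filter of small positive
    radii. *)
Lemma cont_on_unif A f (e : R) : compact A -> cont_on A f -> 0 < e ->
  exists2 r : R, 0 < r & forall x y, A x -> A y -> `|x - y| < r ->
    `|f x - f y| <= e.
Proof.
move=> /compact_near_coveringP cA cf e0.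
have [|r /= r0 rP] := cA R 0^'+ (fun r x => forall y, A x -> A y -> `|x - y| < r ->
    `|f x - f y| <= e) _.
  move=> x Ax; have e2 : 0 < e / 2 by rewrite divr_gt0.
  have /near_distP[r r0 rP] := cf x Ax _ e2.
  have r2 : 0 < r / 2 by rewrite divr_gt0.
  near=> x' s => y Ax' Ay xy.
  have x'r : `|x' - x| < r / 2.
    by near: x'; apply/near_distP; exists (r / 2).
  have sr : s < r / 2 by near: s; exact: nbhs_right_lt.
  have Hx' := rP x' ltac:(lra) Ax'.
  have Hy : `|f y - f x| <= e / 2.
    apply: rP => //; have -> : y - x = (y - x') + (x' - x) by rewrite addrA subrK.
    rewrite distrC in xy; apply: (le_lt_trans (ler_normD _ _)).
    by rewrite [r]splitr ltrD // (lt_trans xy).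
  have -> : f x' - f y = (f x' - f x) - (f y - f x) by ring.
  by apply: (le_trans (ler_normB _ _)); lra.
have r2 : 0 < r / 2 by rewrite divr_gt0.
exists (r / 2) => // x y Ax Ay xy; apply: (rP (r / 2)) => //.
by rewrite /= sub0r normrN gtr0_norm //; lra.
Unshelve. all: by end_near. Qed.

Lemma cont_on_argmax A f : A !=set0 -> compact A -> cont_on A f ->
  exists2 c, A c & forall x, A x -> f x <= f c.
Proof.
move=> A0 cA /cont_onP cf; have [c cc cmax] := EVT_max_rV A0 cA cf.
by rewrite inE in cc; exists c => // x Ax; apply: cmax; rewrite inE.
Qed.

Lemma cont_onW A B f : B `<=` A -> cont_on A f -> cont_on B f.
Proof.
move=> BA cf x Bx e e0; apply: filterS (cf x (BA _ Bx) e e0) => y fy By.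
exact/fy/BA.
Qed.

Lemma cont_onN A f : cont_on A f -> cont_on A (fun x => - f x).
Proof.
move=> cf x Ax e e0; apply: filterS (cf x Ax e e0) => y fy Ay.
by rewrite -opprD normrN; exact: fy.
Qed.

Lemma cont_onD A f g : cont_on A f -> cont_on A g -> cont_on A (fun x => f x + g x).
Proof.
move=> cf cg x Ax e e0; have e2 : 0 < e / 2 by rewrite divr_gt0.
apply: filterS2 (cf x Ax _ e2) (cg x Ax _ e2) => y fy gy Ay.
rewrite opprD addrACA (le_trans (ler_normD _ _)) // [leRHS]splitr.
by apply: lerD; [exact: fy | exact: gy].
Qed.

Lemma cont_onZ A (c : R) f : cont_on A f -> cont_on A (fun x => c * f x).
Proof.
move=> cf x Ax e e0; have ec : 0 < e / (`|c| + 1) by rewrite divr_gt0 // ltr_wpDl.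
apply: filterS (cf x Ax _ ec) => y fy Ay.
rewrite -mulrBr normrM; apply: (@le_trans _ _ ((`|c| + 1) * `|f y - f x|)).
  by rewrite ler_wpM2r // lerDl.
by rewrite mulrC -ler_pdivlMr ?ltr_wpDl //; exact: fy.
Qed.

End ContinuousOn.

(** * Estimates for matrices, quadratic polynomials and real powers *)

Section Aux.
Variables (R : realType) (n : nat).
Implicit Types (p q d x y : 'rV[R]_n) (X Y : 'M[R]_n) (f g : 'rV[R]_n -> R).

Lemma entry_le_norm X i j : `|X i j| <= `|X|.
Proof. by have := lexx `|X|; rewrite {1}[`|X|]mx_normrE => /bigmax_leP[_ /(_ (i, j) isT)]. Qed.

Lemma norm_mulmx_le d X : `|d *m X| <= n%:R * `|d| * `|X|.
Proof.
apply: norm_lev => [|j]; first by rewrite !mulr_ge0.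
rewrite mxE (le_trans (ler_norm_sum _ _ _)) //.
rewrite -mulrA mulr_natl -[X in _ *+ X]card_ord -sumr_const; apply: ler_sum => i _.
by rewrite normrM ler_pM // ?coord_le_norm // entry_le_norm.
Qed.

Lemma mulmx_small X (e : R) : 0 < e ->
  \forall d \near (0 : 'rV[R]_n), `|d *m X| < e.
Proof.
move=> e0; have C0 : 0 < n%:R * `|X| + 1 by rewrite ltr_wpDl // mulr_ge0.
apply/near0P; exists (e / (n%:R * `|X| + 1)); first by rewrite divr_gt0.
move=> d; rewrite ltr_pdivlMr // => dC; apply: le_lt_trans dC.
apply: (le_trans (norm_mulmx_le _ _)); rewrite mulrAC mulrC.
by rewrite ler_wpM2l // lerDl.
Qed.

Lemma quad_small p X (e : R) : 0 < e ->
  \forall d \near (0 : 'rV[R]_n), `|quad p X d| <= e.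
Proof.
move=> e0; have C0 : 0 < n%:R * (`|p| + 1) + 1 by rewrite ltr_wpDl // mulr_ge0 // addr_ge0.
have [r r0 rP] := (near0P _).1 (mulmx_small X (ltr01 : 0 < (1 : R))).
apply/near0P; exists (Num.min r (e / (n%:R * (`|p| + 1) + 1))).
  by rewrite lt_min r0 divr_gt0.
move=> d; rewrite lt_min => /andP[/rP dX]; rewrite ltr_pdivlMr // => dC.
have -> : quad p X d = dotv (p + 2^-1 *: (d *m X)) d.
  by rewrite /quad dotvDl dotvZl mulrC.
apply: (le_trans (dotv_norm _ _)); apply: le_trans (ltW dC).
rewrite mulrC ler_wpM2l //.
have : `|p + 2^-1 *: (d *m X)| <= `|p| + 1.
  rewrite (le_trans (ler_normD _ _)) // lerD2l normrZ gtr0_norm ?invr_gt0 //.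
  by have := normr_ge0 (d *m X); lra.
by move=> /(ler_wpM2l (ler0n R n)) /le_trans; apply; rewrite lerDl.
Qed.

Lemma powR_le (a b k : R) : 0 <= k -> 0 <= a -> a <= b -> a `^ k <= b `^ k.
Proof.
by move=> k0 a0 ab; apply: ge0_ler_powR => //; rewrite nnegrE ?(le_trans a0).
Qed.

Lemma powR_lt1 (a k : R) : 0 < k -> 0 <= a -> a < 1 -> a `^ k < 1.
Proof.
move=> k0 a0 a1; rewrite -[ltRHS](congr1 (@^~ k) (powR1 R)); apply: gt0_ltr_powR => //.
by rewrite nnegrE.
Qed.

Lemma powR_continuous_at (a k : R) : 0 < a -> {for a, continuous (fun t => t `^ k)}.
Proof.
move=> a0; apply: differentiable_continuous; apply/derivable1_diffP.
by apply: derivable_powR; rewrite in_itv /= a0.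
Qed.

Lemma near_mul_powR f g y (k e : R) : {for y, continuous f} -> {for y, continuous g} ->
  0 < g y -> 0 < e ->
  \forall x \near y, `|f x * g x `^ k - f y * g y `^ k| <= e.
Proof.
move=> cf cg gy e0.
have cgk : (fun x => g x `^ k) @ y --> g y `^ k.
  exact: (@continuous_comp _ _ _ g (fun t => t `^ k) y cg (powR_continuous_at gy)).

have cM : {for y, continuous (f \* (fun x => g x `^ k))} by exact: continuousM cf cgk.
have /cvgrPdist_le/(_ e e0) := cM.
by apply: filterS => x; rewrite distrC.
Qed.

Lemma cont_on_for (A : set 'rV[R]_n) f y : open A -> A y -> cont_on A f ->
  {for y, continuous f}.
Proof.
move=> oA Ay cf; apply/(@cvgrPdist_le _ _ _ _ (nbhs_filter y)) => e e0.
rewrite near_simpl.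
have nA : \forall x \near y, A x by exact: open_nbhs_nbhs.
by apply: filterS2 (cf y Ay e e0) nA => x fx /fx; rewrite distrC.
Qed.

(** This is why a maximum of subsolutions is a subsolution: a paraboloid touching the maximum
    touches whichever function attains it. *)
Lemma jet_above_le f g y p X : f y = g y ->
  (\forall d \near (0 : 'rV[R]_n), f (y + d) <= g (y + d)) ->
  jet_above g y p X -> jet_above f y p X.
Proof.
move=> fg fleg gJ; apply: filterS2 fleg gJ => d ? ?.
by rewrite fg; lra.
Qed.

Lemma bounded_closure_compact (A : set 'rV[R]_n) : bounded_set A -> compact (closure A).
Proof.
move=> [M [Mreal bA]]; apply: bounded_closed_compact; last exact: closed_closure.
exists M; split => // N MN; have AN : A `<=` [set x | `|x| <= N] by move=> x; exact: bA.
have cN : closed [set x : 'rV[R]_n | `|x| <= N].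
  apply: (preimage_closed (f := fun x : 'rV[R]_n => `|x|) (D := [set t : R | t <= N])).
    by move=> x _; exact: norm_continuous.
  exact: closed_le.
by move=> x Ax; have := closure_subset AN Ax; rewrite -(closure_id _).1.
Qed.

Lemma boundary_openE (A : set 'rV[R]_n) : open A -> boundary A = closure A `\` A.
Proof. by move=> oA; rewrite /boundary (interior_id _).1. Qed.

Lemma cont_on_quad (A : set 'rV[R]_n) p X y : symmx X ->
  cont_on A (fun x => quad p X (x - y)).
Proof.
move=> sX x _ e e0; apply/near_shift0.
apply: filterS (quad_small (p + (x - y) *m X) X e0) => d dq _.
have -> : x + d - y = (x - y) + d by rewrite addrAC.
by rewrite quad_shift // (addrC (quad p X _)) addrK.
Qed.

End Aux.

(** * The Perron class and its envelope *)

Section Shrink.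
Variable R : realType.
Implicit Types c e s t : R.

(** [t + e <= s + 3 e <= s (c + 3 e) / c], the last step because [s >= c]. The [2 e] makes room for
    two errors of size [e]. *)
Lemma shrink_le c e s t : 0 < c -> 0 < e -> c <= s -> t <= s + 2 * e ->
  c / (c + 3 * e) * (t + e) <= s.
Proof.
move=> c0 e0 cs ts; have ce : 0 < c + 3 * e by lra.
rewrite mulrAC ler_pdivrMr //.
have h1 : 0 <= c * (s + 2 * e - t) by rewrite mulr_ge0 ?(ltW c0) // subr_ge0.
have h2 : 0 <= e * (s - c) by rewrite mulr_ge0 ?subr_ge0 ?(ltW e0).
lra.
Qed.

(** Undoing the rescaling: [t + e <= s + 3 e s / c], and [3 e s / c <= 3 e M / c = d]. *)
Lemma unshrink_le c e s t M d : 0 < c -> 0 < e -> s <= M -> 3 * e * M = d * c ->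
  c / (c + 3 * e) * (t + e) <= s -> t <= s + d.
Proof.
move=> c0 e0 sM dE; have ce : 0 < c + 3 * e by lra.
rewrite mulrAC ler_pdivrMr // => h.
have h1 : e * s <= e * M by rewrite ler_pM2l.
have h2 : 0 <= c * e by rewrite mulr_ge0 ?(ltW c0) ?(ltW e0).
rewrite -(ler_pM2l c0); lra.
Qed.

End Shrink.

Section Perron.
Variables (R : realType) (n : nat) (Omega : set 'rV[R]_n).
Variables (H : 'rV[R]_n -> 'M[R]_n -> R) (k : R).
Variables (b U h : 'rV[R]_n -> R) (c0 : R).
Implicit Types (p d x y z : 'rV[R]_n) (X Y : 'M[R]_n) (w : 'rV[R]_n -> R).

(** The subsolution inequality at one point in jet form. For positive [w] the zero-order term is
    [b w^k]; in the application [b = lambda a]. *)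
Definition sub_at w y : Prop := forall p X, symmx X -> jet_above w y p X ->
  0 <= H p X + b y * w y `^ k.

Definition perron_class w : Prop :=
  [/\ cont_on (closure Omega) w,
      forall x, closure Omega x -> c0 <= w x <= U x,
      forall x, boundary Omega x -> w x <= h x &
      forall y, Omega y -> sub_at w y].

Definition envelope x : R := sup [set w x | w in perron_class].

Hypothesis oO : open Omega.
Hypothesis bO : bounded_set Omega.
Hypothesis Hadm : admissible H.
Hypothesis HA : condA H.
Hypothesis k0 : 0 < k.
Hypothesis Hhom : forall (t : R) p X, symmx X -> 0 < t ->
  H (t *: p) (t *: X) = t `^ k * H p X.
Hypothesis bc : cont_on Omega b.
Hypothesis bpos : forall x, Omega x -> 0 < b x.
Hypothesis c0pos : 0 < c0.
Hypothesis Uc : cont_on (closure Omega) U.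
Hypothesis Uge : forall x, closure Omega x -> c0 <= U x.
Hypothesis Usuper : forall y p X, Omega y -> symmx X -> jet_below U y p X ->
  H p X + b y * U y `^ k <= 0.
Hypothesis hge : forall x, boundary Omega x -> c0 <= h x.

Let clO := closure Omega.
Let clE x : Omega x -> clO x. Proof. exact: subset_closure. Qed.
Let bdE x : boundary Omega x <-> clO x /\ ~ Omega x.
Proof. by rewrite boundary_openE. Qed.
Let ccl : compact clO. Proof. exact: bounded_closure_compact. Qed.

(** The new function is [max w1 w2] on all of [O] and [w1] off [K]. These two relatively open
    regions cover everything, and both continuity and the jet condition are local. *)
Lemma perron_glue w1 w2 (K O : set 'rV[R]_n) :
  perron_class w1 -> open O -> O `<=` Omega -> closed K -> K `<=` O ->
  cont_on O w2 -> (forall y, O y -> sub_at w2 y) ->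
  (forall x, O x -> ~ K x -> w2 x <= w1 x) ->
  (forall x, K x -> w2 x <= U x) ->
  perron_class (fun x => if `[< K x >] then Num.max (w1 x) (w2 x) else w1 x).
Proof.
move=> [w1c w1b w1h w1s] oOO OO cK KO w2c w2s w21 w2U; set W := fun x => _.
have WO x : O x -> W x = Num.max (w1 x) (w2 x).
  move=> Ox; rewrite /W; case: asboolP => // /(w21 x Ox) w21x.
  by apply/esym/max_idPl.
have WN x : ~ K x -> W x = w1 x by rewrite /W; case: asboolP.
have Wge x : w1 x <= W x.
  by rewrite /W; case: asboolP => // _; rewrite le_max lexx.
have nO x : O x -> \forall y \near x, O y.
  by move=> Ox; exact: open_nbhs_nbhs.
have nK x : ~ K x -> \forall y \near x, ~ K y.
  by move=> Kx; apply: open_nbhs_nbhs; split => //; exact: closed_openC.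
split.
- move=> x clx e e0; case: (pselect (K x)) => [/KO Ox|nKx].
    apply: filterS3 (nO x Ox) (w1c x clx e e0) (w2c x Ox e e0) => y Oy w1y w2y cly.
    by rewrite !WO //; apply: normB_max_le; [exact: w1y | exact: w2y].
  apply: filterS2 (nK x nKx) (w1c x clx e e0) => y Ky w1y cly.
  by rewrite !WN //; exact: w1y.
- move=> x clx; have /andP[w1x1 w1x2] := w1b x clx; rewrite (le_trans w1x1) //=.
  rewrite /W; case: asboolP => // Kx; rewrite ge_max w1x2 /=; exact: w2U.
- move=> x /[dup] bx /bdE[_ nOx]; rewrite WN; first exact: w1h.
  by move=> /KO/OO.
- move=> y Oy p X sX WJ.
  have J1 : W y = w1 y -> 0 <= H p X + b y * W y `^ k.
    move=> Wy; rewrite Wy; apply: w1s => //; apply: jet_above_le WJ => //.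
    by apply/near0P; exists 1 => // d _; exact: Wge.
  case: (pselect (K y)) => [/KO OOy|/WN //].
  move: J1; rewrite {1}WO //; case: (leP (w1 y) (w2 y)) => [w12 _|w21y]; last by apply.
  have Wy : W y = w2 y by rewrite WO //; exact/max_idPr.
  rewrite Wy; apply: w2s => //; apply: jet_above_le WJ => //.
  have nOd : \forall d \near (0 : 'rV[R]_n), O (y + d).
    exact: ((near_shift0 y O).1 (nO y OOy)).
  apply: (@filterS _ _ (nbhs_filter _) _ _ _ nOd) => d Od.
  by rewrite WO // le_max lexx orbT.
Qed.

Lemma perron_max w1 w2 : perron_class w1 -> perron_class w2 ->
  perron_class (fun x => Num.max (w1 x) (w2 x)).
Proof.
move=> [w1c w1b w1h w1s] [w2c w2b w2h w2s]; split.
- exact: cont_on_max.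
- move=> x clx; have /andP[? ?] := w1b x clx; have /andP[? ?] := w2b x clx.
  by apply/andP; rewrite le_max ge_max; split; apply/andP || apply/orP; [left|].
- by move=> x bx; rewrite ge_max w1h //= w2h.
- move=> y Oy p X sX WJ; case: (leP (w1 y) (w2 y)) => w12.
    apply: w2s => //; apply: jet_above_le WJ; first exact/esym/max_idPr.
    by apply/near0P; exists 1 => // d _; rewrite le_max lexx orbT.
  apply: w1s => //; apply: jet_above_le WJ; first exact/esym/max_idPl/ltW.
  by apply/near0P; exists 1 => // d _; rewrite le_max lexx.
Qed.

(** A paraboloid touching a constant from above has [X >= 0], so [H p X >= H p 0 = 0]. *)
Lemma sub_at_cst (c : R) y : Omega y -> 0 <= c -> sub_at (cst c) y.
Proof.
move=> Oy c00 p X sX J; have [p0 X0] : 0 = p /\ lemx 0 X.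
  apply: quad_touch => e e0; apply: filterS J => d /=.
  rewrite /quad dotv0l mulmx0 dotv0l mul0r addr0 sub0r.
  by have := mulr_ge0 (ltW e0) (dotv_ge0 d); lra.
have s0 : symmx (0 : 'M[R]_n) by rewrite /symmx /= trmx0.
have := HA p s0 sX X0; have [_ ->] := Hadm; move=> HpX.
by rewrite addr_ge0 // mulr_ge0 ?powR_ge0 // ltW // bpos.
Qed.

Lemma perron_cst : perron_class (cst c0).
Proof.
split=> //.
- exact: cont_on_cst.
- by move=> x clx; rewrite lexx Uge.
- by move=> y Oy; apply: sub_at_cst => //; exact: ltW.
Qed.

Lemma le_envelope w x : perron_class w -> clO x -> w x <= envelope x.
Proof.
move=> wS clx; apply: ub_le_sup; last by exists w.
by exists (U x) => _ [w' [_ w'b _ _] <-]; have /andP[] := w'b x clx.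
Qed.

Lemma envelope_le x (M : R) : (forall w, perron_class w -> w x <= M) ->
  envelope x <= M.
Proof.
move=> wM; apply: ge_sup; last by move=> _ [w wS <-]; exact: wM.
by exists c0; exists (cst c0) => //; exact: perron_cst.
Qed.

Lemma envelope_bounds x : clO x -> c0 <= envelope x <= U x.
Proof.
move=> clx; apply/andP; split; first exact: (le_envelope perron_cst clx).
by apply: envelope_le => w [_ wb _ _]; have /andP[] := wb x clx.
Qed.

(** The neighbourhood is chosen before [w], so that the bound passes to the envelope. *)
Hypothesis hup : forall y (e : R), boundary Omega y -> 0 < e ->
  \forall x \near y, clO x -> forall w, perron_class w -> w x <= h y + e.
Hypothesis hlow : forall y (e : R), boundary Omega y -> 0 < e ->
  exists2 w, perron_class w & h y - e <= w y.

Lemma envelope_boundary_near y (e : R) : boundary Omega y -> 0 < e ->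
  exists2 w, perron_class w & \forall x \near y, clO x ->
    [/\ h y - e <= w x, envelope x <= h y + e & envelope x <= w x + e].
Proof.
move=> by_ e0; have e4 : 0 < e / 4 by rewrite divr_gt0.
have [w wS wy] := hlow by_ e4; exists w => //.
have [cly _] := (bdE y).1 by_.
have [wc _ _ _] := wS.
apply: filterS2 (hup by_ e4) (wc y cly _ e4) => x Hx wx clx.
have := wx clx; rewrite ler_norml => /andP[? ?].
have : envelope x <= h y + e / 4 by apply: envelope_le; exact: Hx.
by move=> ?; split; lra.
Qed.

Lemma boundary_compact : compact (boundary Omega).
Proof.
apply: (@subclosed_compact _ _ clO) => //; last by move=> x [].
rewrite boundary_openE // setDE; apply: closedI; first exact: closed_closure.
exact: open_closedC.
Qed.

(* Compactness of the boundary, used along the filter of all (w', r') with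
   w' above w and r' below r: the class is directed. *)
Lemma envelope_near_boundary (e : R) : 0 < e ->
  exists w (r : R), [/\ perron_class w, 0 < r &
    forall x y, clO x -> boundary Omega y -> `|x - y| < r ->
      envelope x <= w x + e].
Proof.
move=> e0; have /compact_near_coveringP cb := boundary_compact.
pose D : set (('rV[R]_n -> R) * R) := [set i | perron_class i.1 /\ 0 < i.2].
pose B (i : ('rV[R]_n -> R) * R) : set (('rV[R]_n -> R) * R) :=
  [set j | (forall x, i.1 x <= j.1 x) /\ j.2 <= i.2].
pose P (i : ('rV[R]_n -> R) * R) y := forall x, clO x -> `|x - y| < i.2 ->
  envelope x <= i.1 x + e.
have FF : Filter (filter_from D B).
  apply: filter_from_filter; first by exists (cst c0, 1); split => //; exact: perron_cst.
  move=> [w1 r1] [w2 r2] [/= w1S r10] [/= w2S r20].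
  exists (fun x => Num.max (w1 x) (w2 x), Num.min r1 r2).
    by split => /=; [exact: perron_max | rewrite lt_min r10].
  move=> [w r] [/= wge]; rewrite le_min => /andP[? ?].
  by split; split => //= x; have := wge x; rewrite ge_max => /andP[].
have [|[w r] [/= wS r0] BP] := cb _ _ P FF.
  move=> y by_; have [w wS /near_distP[r r0 rP]] := envelope_boundary_near by_ e0.
  have r2 : 0 < r / 2 by rewrite divr_gt0.
  exists ([set y' | `|y' - y| < r / 2], B (w, r / 2)); first split => /=.
  - by apply/near_distP; exists (r / 2).
  - by exists (w, r / 2).
  move=> [y' [w' r']] [/= y'r [/= w'w r'r]] x clx xy'.
  have [|_ _ /le_trans] := rP x _ clx; last by apply; rewrite lerD2r.
  rewrite -(subrK y' x) -addrA (le_lt_trans (ler_normD _ _)) //.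
  by rewrite [r]splitr ltrD // (lt_le_trans xy').
exists w, r; split => // x y clx by_ xy; apply: (BP (w, r)) by_ x clx xy.
by split => /=.
Qed.

(* As w <= M, adding e to w multiplies w^k by at least ((M + e) / M)^k, which
   leaves room for replacing b (y + z) by b y. *)
Lemma sub_at_shift w z y (t e M : R) :
  Omega y -> Omega (y + z) -> 0 < t -> 0 < e -> 0 < w (y + z) <= M ->
  b (y + z) * (M / (M + e)) `^ k <= b y -> sub_at w (y + z) ->
  sub_at (fun x => t * (w (x + z) + e)) y.
Proof.
move=> Oy Oyz t0 e0 /andP[w0 wM] bq ws p X sX J.
have M0 : 0 < M by exact: lt_le_trans wM.
have sX' : symmx (t^-1 *: X) by exact: symmxZ.
have J' : jet_above w (y + z) (t^-1 *: p) (t^-1 *: X).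
  apply: filterS J => d /=; rewrite quadZ (addrAC y z d) => Jd.
  by rewrite -(ler_pM2l t0) mulrDr mulrA mulfV ?gt_eqF // mul1r; lra.
have := ws _ _ sX' J'; rewrite Hhom ?invr_gt0 // => Hw.
have tk : 0 < t `^ k by rewrite powR_gt0.
have Vt : t^-1 `^ k = (t `^ k)^-1.
  by rewrite -powR_inv1 ?ltW // -powRrM mulN1r powRN.
have {}Hw : 0 <= H p X + t `^ k * (b (y + z) * w (y + z) `^ k).
  rewrite -(pmulr_rge0 _ tk) mulrDr Vt mulrA mulfV ?gt_eqF // mul1r in Hw.
  by [].
apply: (le_trans Hw); rewrite lerD2l powRM ?(ltW t0) ?addr_ge0 ?(ltW w0) ?(ltW e0) //.
rewrite (mulrCA (b y)) ler_pM2l //.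
have We : 0 < w (y + z) + e by rewrite addr_gt0.
have Me : 0 < M + e by rewrite addr_gt0.
have wq : w (y + z) `^ k <= (M / (M + e)) `^ k * (w (y + z) + e) `^ k.
  rewrite -powRM ?divr_ge0 ?(ltW M0) ?(ltW Me) ?(ltW We) //.
  apply: powR_le; [exact: ltW | exact: ltW |].
  by rewrite mulrAC ler_pdivlMr //; nra.
apply: (@le_trans _ _ (b (y + z) * ((M / (M + e)) `^ k * (w (y + z) + e) `^ k))).
  by rewrite ler_wpM2l // ltW // bpos.
by rewrite mulrA ler_wpM2r // powR_ge0.
Qed.

(** The gap [b x (1 - q)] absorbs the oscillation of [b] near [x]; compactness of [K] makes the
    admissible size of [z] uniform. *)
Lemma translate_room (K : set 'rV[R]_n) (q : R) : compact K -> K `<=` Omega ->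
  0 < q -> q < 1 ->
  exists2 r : R, 0 < r & forall z x, `|z| < r -> K x ->
    [/\ Omega x, Omega (x + z) & b (x + z) * q < b x].
Proof.
move=> /compact_near_coveringP cK KO q0 q1.
pose P z x := [/\ Omega x, Omega (x + z) & b (x + z) * q < b x].
suff : \forall z \near (0 : 'rV[R]_n), K `<=` P z.
  by move=> /near0P[r r0 rP]; exists r => // z x zr Kx; exact: rP.
apply: (cK _ _ P (nbhs_filter _)) => x Kx.
have Ox := KO x Kx; have bx := bpos Ox.
pose e := b x * (1 - q) / 4.
have e0 : 0 < e by rewrite divr_gt0 // mulr_gt0 // subr_gt0.
have nO : \forall y \near x, Omega y by exact: open_nbhs_nbhs.
have /near_distP[r r0 rP] : \forall y \near x, Omega y /\ `|b y - b x| <= e.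
  by apply: filterS2 nO (bc Ox e0) => y Oy by_; split => //; exact: by_.
have r2 : 0 < r / 2 by rewrite divr_gt0.
exists ([set y | `|y - x| < r / 2], [set z | `|z| < r / 2]); first split => /=.
- by apply/near_distP; exists (r / 2).
- by apply/near0P; exists (r / 2).
move=> [y z] [/= yr zr].
have [Oy] := rP y ltac:(lra).
have yzr : `|y + z - x| < r.
  rewrite addrAC (le_lt_trans (ler_normD _ _)) //.
  by rewrite [r]splitr ltrD.
have [Oyz] := rP _ yzr.
rewrite !ler_norml => /andP[_ h1] /andP[h2 _]; split => //.
have h3 : b (y + z) * q <= (b x + e) * q by rewrite ler_pM2r //; lra.
have h4 : e * q <= e by rewrite ler_piMr // ltW.
apply: (le_lt_trans h3); rewrite mulrDl.
have : b x * q + e + e < b x.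
  have -> : b x * q + e + e = b x - b x * (1 - q) / 2 by rewrite /e; field.
  by rewrite ltrBlDr ltrDl divr_gt0 // mulr_gt0 // subr_gt0.
lra.
Qed.

Lemma translate_open z (q : R) : 0 < q -> q < 1 ->
  open [set x | [/\ Omega x, Omega (x + z) & b (x + z) * q < b x]].
Proof.
move=> q0 q1; rewrite openE => x [Ox Oxz bxz].
pose e := (b x - b (x + z) * q) / 4.
have e0 : 0 < e by rewrite divr_gt0 // subr_gt0.
have nO y : Omega y -> \forall y' \near y, Omega y' by move=> Oy; exact: open_nbhs_nbhs.
have /near_distP[r1 r10 r1P] : \forall y \near x, Omega y /\ `|b y - b x| <= e.
  by apply: filterS2 (nO x Ox) (bc Ox e0) => y Oy by_; split => //; exact: by_.
have /near_distP[r2 r20 r2P] : \forall y \near x + z, Omega y /\ `|b y - b (x + z)| <= e.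
  by apply: filterS2 (nO _ Oxz) (bc Oxz e0) => y Oy by_; split => //; exact: by_.
apply/near_distP; exists (Num.min r1 r2); first by rewrite lt_min r10.
move=> y; rewrite lt_min => /andP[/r1P[Oy] y1 y2].
have [] := r2P (y + z); first by rewrite opprD addrACA subrr addr0.
move=> Oyz; move: y1; rewrite !ler_norml => /andP[h1 _] /andP[_ h2]; split => //.
have h3 : b (y + z) * q <= (b (x + z) + e) * q by rewrite ler_pM2r //; lra.
have h4 : e * q <= e by rewrite ler_piMr // ltW.
have : b x = b (x + z) * q + 4 * e by rewrite /e; field.
by rewrite mulrDl in h3; lra.
Qed.

(* Walsh's device: a slightly raised and rescaled translate of a subsolution
   w lies below the envelope near the boundary, hence glues to a member of
   the class; comparing it with the envelope gives equicontinuity, with no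
   comparison principle. *)
Lemma envelope_translate x0 (e : R) : Omega x0 -> 0 < e ->
  exists2 r : R, 0 < r & forall x x', `|x - x0| < r -> `|x' - x0| < r ->
    [/\ Omega x, Omega x' & envelope x' <= envelope x + e].
Proof.
move=> Ox0 e0.
have [xM clM UM] : exists2 c, clO c & forall x, clO x -> U x <= U c.
  by apply: cont_on_argmax => //; exists x0; exact: clE.
set M := U xM in UM.
have cM : c0 <= M by exact: Uge.
have M0 : 0 < M by exact: lt_le_trans cM.
(* By [unshrink_le], undoing the rescaling costs [3 e1 M / c0], which is now exactly [e]. *)
pose e1 := e * c0 / (3 * M).
have e10 : 0 < e1 by rewrite divr_gt0 ?mulr_gt0.
have e1E : 3 * e1 * M = e * c0 by rewrite /e1; field; rewrite gt_eqF.
clearbody e1; have [wL [t0 [wLS t00 wLt]]] := envelope_near_boundary e10.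
have [wLc wLb wLh wLs] := wLS.
have [r1 r10 r1P] := cont_on_unif ccl Uc e10.
have [r2 r20 r2P] := cont_on_unif ccl wLc e10.
have /near_distP[rho rho0 rhoP] : \forall y \near x0, Omega y by exact: open_nbhs_nbhs.
(* Within [t] of the boundary the envelope is at most [wL + e1]; the bound by [rho / 2] ensures that
   points close to [x0] belong to [K]. *)
pose t := Num.min t0 (rho / 2).
have tt0 : 0 < t by rewrite lt_min t00 divr_gt0.
have [tle1 tle2] : t <= t0 /\ t <= rho / 2 by rewrite /t !ge_min !lexx orbT.
pose K := [set x | clO x /\ forall y, boundary Omega y -> t / 2 <= `|x - y|].
have cK : closed K.
  have -> : K = clO `&` \bigcap_(y in boundary Omega) [set x | t / 2 <= `|x - y|].
    by apply/seteqP; split => x [].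
  apply: closedI; first exact: closed_closure.
  apply: closed_bigI => y _.
  apply: (preimage_closed (f := fun x : 'rV[R]_n => `|x - y|) (D := [set s : R | t / 2 <= s])).
    move=> x _; apply: (@continuous_comp _ _ _ (fun x => x - y) (fun x : 'rV[R]_n => `|x|)).
      exact: (cvgB cvg_id (cvg_cst _)).
    exact: norm_continuous.
  exact: closed_ge.
have kK : compact K by apply: (subclosed_compact cK ccl) => x [].
have KO : K `<=` Omega.
  move=> x [clx bx]; apply: contrapT => nOx.
  have /bx : boundary Omega x by apply/bdE.
  by rewrite subrr normr0; lra.
(* Raising a [w <= M] by [e1] gains at least the factor [1 / q] in [w^k]. *)
pose q := (M / (M + e1)) `^ k.
have Me : 0 < M + e1 by rewrite addr_gt0.
have q0 : 0 < q by rewrite powR_gt0 // divr_gt0.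
have q1 : q < 1.
  by apply: powR_lt1; rewrite ?divr_ge0 ?(ltW M0) ?(ltW Me) // ltr_pdivrMr // mul1r ltrDl.
have [r3 r30 r3P] := translate_room kK KO q0 q1.
(* The shift between two points within [r] of [x0] is shorter than [2 r]; it must respect [t / 2],
   the moduli [r1] and [r2], and the room [r3]. *)
pose r := Num.min (Num.min (rho / 2) (t / 4)) (Num.min (r1 / 2) (Num.min (r2 / 2) (r3 / 2))).
have r0 : 0 < r by rewrite !lt_min !divr_gt0.
have [rl1 rl2 rl3 rl4 rl5] : [/\ r <= rho / 2, r <= t / 4, r <= r1 / 2, r <= r2 / 2 & r <= r3 / 2].
  by rewrite /r !ge_min !lexx !orbT.
clearbody r; exists r => // x x' xr x'r.
have Ox : Omega x by apply: rhoP; lra.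
have Ox' : Omega x' by apply: rhoP; lra.
split => //.
have Kx : K x.
  split; first exact: clE.
  move=> y /bdE[_ nOy]; rewrite leNgt; apply/negP => xy; apply: nOy; apply: rhoP.
  rewrite -(subrK x y) -addrA (le_lt_trans (ler_normD _ _)) //.
  by rewrite [rho]splitr ltrD //; [rewrite distrC|]; lra.
pose z := x' - x; have xz : x + z = x' by rewrite addrC subrK.
have zr : `|z| < 2 * r.
  have -> : z = (x' - x0) + (x0 - x) by rewrite addrA subrK.
  by rewrite (le_lt_trans (ler_normD _ _)) // (distrC x0) mulr_natl mulr2n ltrD.
have /andP[vc vU] := envelope_bounds (clE Ox).
have vM : envelope x <= M by apply: (le_trans vU); exact/UM/clE.
apply: envelope_le => w wS; have [wc wb wh ws] := wS.
pose th := c0 / (c0 + 3 * e1).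
have ce : 0 < c0 + 3 * e1 by rewrite addr_gt0 // mulr_gt0.
have th0 : 0 < th by rewrite divr_gt0.
have th_le (s s' : R) : c0 <= s -> s' <= s + 2 * e1 -> th * (s' + e1) <= s.
  exact: shrink_le.
pose w2 y := th * (w (y + z) + e1).
pose O := [set y | [/\ Omega y, Omega (y + z) & b (y + z) * q < b y]].
have zt : `|z| < t / 2 by lra.
have wM y : clO y -> w y <= M.
  by move=> cly; have /andP[_ /le_trans] := wb y cly; apply; exact: UM.
have oOz : open O by exact: translate_open.
have OOm : O `<=` Omega by move=> y [].
have KOz : K `<=` O by move=> y Ky; apply: r3P => //; lra.
have w2c : cont_on O w2.
  apply: cont_onZ; apply: cont_onD; last exact: cont_on_cst.
  move=> y [_ Oyz _] e2 e20; have /near_distP[s s0 sP] := wc _ (clE Oyz) e2 e20.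
  apply/near_distP; exists s => // y' y's [_ Oy'z _].
  by apply: sP; [rewrite opprD addrACA subrr addr0 | exact: clE].
have w2s y : O y -> sub_at w2 y.
  move=> [Oy Oyz bq]; apply: (sub_at_shift (M := M)) => //; last 2 first.
  - exact: ltW.
  - exact: ws.
  have /andP[wc0 _] := wb _ (clE Oyz).
  by rewrite (lt_le_trans c0pos wc0) wM //; exact: clE.
(* Off [K] the point [y + z] is within [t] of the boundary, so [w (y + z) <= wL (y + z) + e1 <= wL y
   + 2 e1]: these are the two errors allowed by [shrink_le]. *)
have w2L y : O y -> ~ K y -> w2 y <= wL y.
  move=> [Oy Oyz _] nKy; have /andP[wLc0 _] := wLb _ (clE Oy).
  apply: th_le => //.
  have [y' by' yy'] : exists2 y', boundary Omega y' & `|y - y'| < t / 2.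
    apply: contrapT => nex; apply: nKy; split; first exact: clE.
    by move=> y' by'; rewrite leNgt; apply/negP => yy'; apply: nex; exists y'.
  have := le_envelope wS (clE Oyz).
  have := wLt (y + z) y' (clE Oyz) by' _.
  have -> : `|y + z - y'| < t0 = true.
    rewrite addrAC (le_lt_trans (ler_normD _ _)) //.
    by apply: lt_le_trans tle1; rewrite [t]splitr ltrD.
  move=> /(_ isT).
  have := r2P (y + z) y (clE Oyz) (clE Oy).
  rewrite addrAC subrr add0r => /(_ ltac:(lra)).
  by rewrite ler_norml => /andP[? ?] ? ?; lra.
have w2U y : K y -> w2 y <= U y.
  move=> Ky; have [Oy Oyz _] := KOz y Ky.
  apply: th_le; first exact/Uge/clE.
  have /andP[_ wU] := wb _ (clE Oyz).
  have := r1P (y + z) y (clE Oyz) (clE Oy).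
  rewrite addrAC subrr add0r => /(_ ltac:(lra)).
  by rewrite ler_norml => /andP[? ?]; lra.
have WS := perron_glue wLS oOz OOm cK KOz w2c w2s w2L w2U.
have := le_envelope WS (clE Ox); rewrite asboolT // ge_max => /andP[_].
by rewrite /w2 xz; exact: (unshrink_le c0pos e10 vM e1E).
Qed.

Lemma envelope_boundary_le y (e : R) : boundary Omega y -> 0 < e ->
  \forall x \near y, clO x -> `|envelope x - h y| <= e.
Proof.
move=> by_ e0; have e2 : 0 < e / 2 by rewrite divr_gt0.
have [w wS wP] := envelope_boundary_near by_ e2.
apply: filterS wP => x wx clx; have [? ? ?] := wx clx.
have := le_envelope wS clx; rewrite ler_norml => ?.
by apply/andP; split; lra.
Qed.

Lemma envelope_boundary y : boundary Omega y -> envelope y = h y.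
Proof.
move=> by_; apply/eqP; rewrite -subr_eq0 -normr_le0; apply: le0_eps => e e0.
have [cly _] := (bdE y).1 by_.
have /near_distP[r r0 rP] := envelope_boundary_le by_ e0.
by apply: rP => //; rewrite subrr normr0.
Qed.

Lemma envelope_cont : cont_on clO envelope.
Proof.
move=> x clx e e0; case: (pselect (Omega x)) => [Ox|nOx].
  have [r r0 rP] := envelope_translate Ox e0.
  apply/near_distP; exists r => // y yr _.
  have xr : `|x - x| < r by rewrite subrr normr0.
  have [_ _ ?] := rP x y xr yr; have [_ _ ?] := rP y x yr xr.
  by rewrite ler_norml; apply/andP; split; lra.
have bx : boundary Omega x by apply/bdE.
apply: filterS (envelope_boundary_le bx e0) => y ey cly.
by rewrite (envelope_boundary bx); exact: ey.
Qed.

Let EcO y : Omega y -> {for y, continuous envelope}.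
Proof.
by move=> Oy; apply: (cont_on_for oO Oy); apply: cont_onW envelope_cont => x; exact: clE.
Qed.

Let bcO y : Omega y -> {for y, continuous b}.
Proof. by move=> Oy; exact: (cont_on_for oO Oy). Qed.

Lemma envelope_gt0 x : clO x -> 0 < envelope x.
Proof. by move=> /envelope_bounds/andP[ec _]; exact: lt_le_trans ec. Qed.

(** A member [w] close to the envelope at the single point [y] suffices. The paraboloid, made strict
    by [eta], slides to touch [w] at a nearby [x1]; there [w] satisfies its inequality and lies
    below the envelope, whose continuity carries the inequality back to [y]. *)
Lemma envelope_sub y : Omega y -> sub_at envelope y.
Proof.
move=> Oy p X sX J; rewrite leNgt; apply/negP => neg.
pose c := - (H p X + b y * envelope y `^ k).
have cE : H p X + b y * envelope y `^ k = - c by rewrite opprK.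
have c_gt0 : 0 < c by rewrite oppr_gt0.
clearbody c; have c4 : 0 < c / 4 by rewrite divr_gt0.
have [rH rH0 rHP] := operator_continuous Hadm p sX c4.
pose eta := rH / 4; have eta0 : 0 < eta by rewrite divr_gt0.
pose X' := X + (2 * eta)%:M.
have sX' : symmx X' by apply: symmxD => //; exact: symmx_scalar.
have X'X : `|X' - X| < rH.
  rewrite /X' addrAC subrr add0r (le_lt_trans (norm_scalar_mx_le _ _)) //.
  by rewrite gtr0_norm ?mulr_gt0 // /eta; lra.
have /near_distP[s1 s10 s1P] := near_mul_powR k (bcO Oy) (EcO Oy) (envelope_gt0 (clE Oy)) c4.
have /near_distP[s2 s20 s2P] : \forall x \near y, Omega x by exact: open_nbhs_nbhs.
have /near0P[s3 s30 s3P] := J.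
have /near0P[s4 s40 s4P] := mulmx_small X' rH0.
pose m := Num.min (Num.min s1 s2) (Num.min s3 s4).
have m0 : 0 < m by rewrite !lt_min s10 s20 s30.
pose s := m / 2; have s0 : 0 < s by rewrite divr_gt0.
have sm : s < m by rewrite /s ltr_pdivrMr // ltr_pMr // ltr1n.
have [sl1 sl2 sl3 sl4] : [/\ s < s1, s < s2, s < s3 & s < s4].
  by split; apply: (lt_le_trans sm); rewrite !ge_min lexx ?orbT.
clearbody s.
pose K := [set x | `|x - y| <= s].
have KO : K `<=` Omega by move=> x /= xs; apply: s2P; exact: le_lt_trans sl2.
have cK : compact K.
  apply: (subclosed_compact _ ccl); last by move=> x /KO/clE.
  apply: (preimage_closed (f := fun x : 'rV[R]_n => `|x - y|) (D := [set t : R | t <= s])).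
    move=> x _; apply: (@continuous_comp _ _ _ (fun x => x - y) (fun x : 'rV[R]_n => `|x|)).
      exact: (cvgB cvg_id (cvg_cst _)).
    exact: norm_continuous.
  exact: closed_le.
(* On the edge of [K] the strictness is at least [eta s^2], twice [del], so the maximum of [f] over
   [K] is interior. *)
pose del := eta * s ^+ 2 / 2.
have del0 : 0 < del by rewrite divr_gt0 // mulr_gt0 // exprn_gt0.
have [w wS wy] : exists2 w, perron_class w & envelope y - del < w y.
  apply: contrapT => nex; have : envelope y <= envelope y - del.
    apply: envelope_le => w wS; rewrite leNgt; apply/negP => wy; apply: nex.
    by exists w.
  by lra.
have [wc _ _ ws] := wS.
pose f x := w x + - quad p X' (x - y).
have Ky : K y by rewrite /K /= subrr normr0 ltW.
have [x1 Kx1 x1max] : exists2 x1, K x1 & forall x, K x -> f x <= f x1.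
  apply: cont_on_argmax => //; first by exists y.
  apply: cont_onD; first by apply: cont_onW wc => x /KO/clE.
  by apply: cont_onN; exact: cont_on_quad.
have wx1 : f y <= f x1 by exact: x1max.
have vx1 : w x1 <= envelope x1 by apply: le_envelope => //; exact/clE/KO.
pose d1 := x1 - y; have x1E : y + d1 = x1 by rewrite addrC subrK.
have d1s : `|d1| <= s by [].
have := s3P d1 (le_lt_trans d1s sl3); rewrite x1E => vq.
have d1lt : `|d1| < s.
  have h1 : eta * dotv d1 d1 <= del.
    move: wx1; rewrite /f subrr quad0 oppr0 addr0 -/d1 /X' quad_scalar; lra.
  rewrite -(ltr_pXn2r (n := 2)) ?nnegrE ?(ltW s0) //.
  apply: le_lt_trans (norm_dotv d1) _; rewrite -(ltr_pM2l eta0).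
  apply: (le_lt_trans h1); rewrite /del ltr_pdivrMr // ltr_pMr ?ltr1n //.
  by rewrite mulr_gt0 // exprn_gt0.
have J1 : jet_above w x1 (p + d1 *m X') X'.
  apply/near0P; exists (s - `|d1|); first by rewrite subr_gt0.
  move=> d ds; have Kd : K (x1 + d).
    rewrite /K /= addrAC -/d1 (le_trans (ler_normD _ _)) //.
    by rewrite addrC -lerBrDr ltW.
  have := x1max _ Kd; rewrite /f addrAC -/d1 quad_shift //; lra.
have Ox1 : Omega x1 by exact: KO.
have := ws x1 Ox1 _ _ sX' J1.
have dX : `|p + d1 *m X' - p| < rH.
  by rewrite addrC addKr; apply: s4P; exact: le_lt_trans sl4.
have := rHP _ _ sX' dX X'X; rewrite ler_norml => /andP[_ h1].
have := s1P x1 (le_lt_trans d1s sl1); rewrite ler_norml => /andP[_ h2].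
have h3 : b x1 * w x1 `^ k <= b x1 * envelope x1 `^ k.
  rewrite ler_wpM2l ?(ltW (bpos Ox1)) //; apply: powR_le => //; first exact: ltW.
  have [_ wb _ _] := wS; have /andP[wc0 _] := wb _ (clE Ox1).
  exact: (le_trans (ltW c0pos)).
lra.
Qed.

Lemma envelope_class : perron_class envelope.
Proof.
split.
- exact: envelope_cont.
- exact: envelope_bounds.
- by move=> x bx; rewrite envelope_boundary.
- exact: envelope_sub.
Qed.

(** Where the envelope meets [U], a paraboloid touching it from below also touches [U]. Elsewhere a
    failure of the inequality would let a raised paraboloid be glued in below [U], giving a member
    of the class that exceeds the envelope at [y]. *)
Lemma envelope_super y p X : Omega y -> symmx X -> jet_below envelope y p X ->
  H p X + b y * envelope y `^ k <= 0.
Proof.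
move=> Oy sX J; rewrite leNgt; apply/negP => c_gt0.
have vy := envelope_gt0 (clE Oy).
have [vUy|vUy] := eqVneq (envelope y) (U y).
  suff : H p X + b y * U y `^ k <= 0 by rewrite -vUy leNgt c_gt0.
  apply: Usuper => //.
  have /near0P[r r0 rP] := J.
  have /near_shiftP[s s0 sP] : \forall x \near y, Omega x by exact: open_nbhs_nbhs.
  apply/near0P; exists (Num.min r s); first by rewrite lt_min r0.
  move=> d; rewrite lt_min => /andP[/rP dr /sP/clE/envelope_bounds/andP[_ ds]].
  by rewrite -vUy; exact: le_trans ds.
have {}vUy : envelope y < U y.
  by rewrite lt_neqAle vUy; have /andP[] := envelope_bounds (clE Oy).
pose c := H p X + b y * envelope y `^ k.
have cE : H p X + b y * envelope y `^ k = c by [].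
rewrite cE in c_gt0; clearbody c; have c4 : 0 < c / 4 by rewrite divr_gt0.
pose g := U y - envelope y.
have gE : U y = envelope y + g by rewrite /g addrC subrK.
have g0 : 0 < g by rewrite subr_gt0.
clearbody g; have g4 : 0 < g / 4 by rewrite divr_gt0.
have [rH rH0 rHP] := operator_continuous Hadm p sX c4.
pose eta := rH / 4; have eta0 : 0 < eta by rewrite divr_gt0.
pose X' := X + (2 * - eta)%:M.
have sX' : symmx X' by apply: symmxD => //; exact: symmx_scalar.
have X'X : `|X' - X| < rH.
  rewrite /X' addrAC subrr add0r (le_lt_trans (norm_scalar_mx_le _ _)) //.
  by rewrite mulrN normrN gtr0_norm ?mulr_gt0 // /eta; lra.
pose Q x := envelope y + quad p X' (x - y).
have Qy : Q y = envelope y by rewrite /Q subrr quad0 addr0.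
have Qc : cont_on setT Q.
  by apply: cont_onD; [exact: cont_on_cst | exact: cont_on_quad].
have Qc1 : {for y, continuous Q} by exact: (cont_on_for openT).
have Qy0 : 0 < Q y by rewrite Qy.
have /near_distP[s1 s10 s1P] := near_mul_powR k (bcO Oy) Qc1 Qy0 c4.
have /near_distP[s2 s20 s2P] : \forall x \near y, Omega x by exact: open_nbhs_nbhs.
have /near0P[s3 s30 s3P] := J.
have /near0P[s4 s40 s4P] := mulmx_small X' rH0.
have /near_distP[s5 s50 s5P] := Uc (clE Oy) g4.
(* The bound by [envelope y / 2] keeps [Q] positive near [y], so that raising it by [mu] increases
   its power. *)
have v2 : 0 < Num.min (g / 4) (envelope y / 2) by rewrite lt_min g4 divr_gt0.
have /near_distP[s6 s60 s6P] := Qc y I _ v2.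
pose s := Num.min (Num.min (Num.min s1 s2) (Num.min s3 s4)) (Num.min s5 s6).
have s0 : 0 < s by rewrite !lt_min s10 s20 s30 s40 s50.
have [sl1 sl2 sl3] : [/\ s <= s1, s <= s2 & s <= s3].
  by split; rewrite !ge_min lexx ?orbT.
have [sl4 sl5 sl6] : [/\ s <= s4, s <= s5 & s <= s6].
  by split; rewrite !ge_min lexx ?orbT.
clearbody s.
(* The second bound puts the raised paraboloid below the envelope outside [K]. The first one, with a
   quarter of [g] for each of the variations of [Q] and [U], keeps it below [U]. *)
pose mu := Num.min (g / 4) (eta * (s / 2) ^+ 2).
have mu0 : 0 < mu by rewrite lt_min g4 mulr_gt0 // exprn_gt0 // divr_gt0.
have [mu1 mu2] : mu <= g / 4 /\ mu <= eta * (s / 2) ^+ 2 by rewrite /mu !ge_min !lexx orbT.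
clearbody mu.
pose O := [set x | `|x - y| < s]; pose K := [set x | `|x - y| <= s / 2].
have dist_cont (x : 'rV[R]_n) : {for x, continuous (fun x : 'rV[R]_n => `|x - y|)}.
  apply: (@continuous_comp _ _ _ (fun x => x - y) (fun x : 'rV[R]_n => `|x|)).
    exact: (cvgB cvg_id (cvg_cst _)).
  exact: norm_continuous.
have oOs : open O.
  apply: (open_comp (f := fun x : 'rV[R]_n => `|x - y|) (D := [set t : R | t < s])).
    by move=> x _; exact: dist_cont.
  exact: open_lt.
have cK : closed K.
  apply: (preimage_closed (f := fun x : 'rV[R]_n => `|x - y|) (D := [set t : R | t <= s / 2])).
    by move=> x _; exact: dist_cont.
  exact: closed_le.
have KO : K `<=` O by move=> x; rewrite /K /O /=; lra.
have OO : O `<=` Omega by move=> x xs; apply: s2P; exact: lt_le_trans sl2.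
pose w2 x := Q x + mu.
have Qnear x : O x -> `|Q x - Q y| <= g / 4 /\ 0 < Q x.
  move=> Ox; have := s6P x (lt_le_trans Ox sl6) I.
  by rewrite le_min Qy !ler_norml => /andP[-> /andP[? ?]]; split => //; lra.
have w2c : cont_on O w2.
  apply: cont_onD; last exact: cont_on_cst.
  exact: cont_onW Qc.
have w2s x : O x -> sub_at w2 x.
  move=> Ox p1 Y sY J1; set d := x - y.
  have ds : `|d| < s by [].
  have [<- XY] : p + d *m X' = p1 /\ lemx X' Y.
    apply: quad_touch => e e0; apply: filterS J1 => d'.
    rewrite /w2 /Q [x + d' - y]addrAC -/d quad_shift //.
    have := mulr_ge0 (ltW e0) (dotv_ge0 d'); lra.
  have := HA (p + d *m X') sX' sY XY.
  have dX : `|p + d *m X' - p| < rH.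
    by rewrite addrC addKr; apply: s4P; exact: lt_le_trans sl4.
  have := rHP _ _ sX' dX X'X; rewrite ler_norml => /andP[h1 _].
  have := s1P x (lt_le_trans Ox sl1); rewrite Qy ler_norml => /andP[h2 _] h3.
  have [_ Qx0] := Qnear x Ox.
  have h4 : b x * Q x `^ k <= b x * w2 x `^ k.
    rewrite ler_wpM2l ?(ltW (bpos (OO _ Ox))) //; apply: powR_le; rewrite ?(ltW k0) ?(ltW Qx0) //.
    by rewrite lerDl ltW.
  lra.
have w2v x : O x -> ~ K x -> w2 x <= envelope x.
  move=> Ox /negP; rewrite -ltNge => xs; set d := x - y.
  have yd : y + d = x by rewrite addrC subrK.
  have := s3P d (lt_le_trans Ox sl3); rewrite yd.
  rewrite /w2 /Q -/d /X' quad_scalar.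
  have : (s / 2) ^+ 2 <= dotv d d.
    apply: le_trans (norm_dotv d).
    by rewrite ler_pXn2r ?nnegrE ?divr_ge0 ?(ltW s0) ?(ltW xs).
  by rewrite -(ler_pM2l eta0); lra.
have w2U x : K x -> w2 x <= U x.
  move=> /KO Ox; have [+ _] := Qnear x Ox.
  have := s5P x (lt_le_trans Ox sl5) (clE (OO _ Ox)).
  by rewrite Qy /w2 !ler_norml => /andP[? ?] /andP[? ?]; lra.
have WS := perron_glue envelope_class oOs OO cK KO w2c w2s w2v w2U.
have Ky : K y by rewrite /K /= subrr normr0 divr_ge0 // ltW.
have := le_envelope WS (clE Oy); rewrite asboolT // ge_max => /andP[_].
by rewrite /w2 Qy; lra.
Qed.

End Perron.

(** * Radial barriers *)

Section PowR.
Variable R : realType.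
Implicit Types a c e s t : R.

Lemma powR_anti a s t : a <= 0 -> 0 < s -> s <= t -> t `^ a <= s `^ a.
Proof.
rewrite -oppr_ge0 -{2 3}(opprK a); move: (- a) => {}a a0 s0 st.
have t0 : 0 < t by exact: lt_le_trans st.
by rewrite !powRN lef_pV2 ?posrE ?powR_gt0 //; apply: powR_le => //; exact: ltW.
Qed.

Lemma is_derive_powR_shift a t s : 0 < s *: (1 : R) + t ->
  is_derive s (1 : R) (fun s : R => (s *: (1 : R) + t) `^ a)
    (a * (s *: (1 : R) + t) `^ (a - 1)).
Proof.
move=> st; apply: (@is_derive_line R R^o (@powR R ^~ a) t 1 s).
exact: is_derive1_powR.
Qed.

(** Dividing by [c] makes the derivative [t^(c - 1)] for either sign of [c]. The mean value bound is
    used twice, first on this derivative and then on the function. *)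
Lemma powR_taylor c t e : c != 0 -> 0 < t -> 0 < e ->
  exists2 r : R, 0 < r & forall s : R, `|s| < r ->
    `|(t + s) `^ c / c - t `^ c / c - t `^ (c - 1) * s
      - (c - 1) * t `^ (c - 2) * s ^+ 2 / 2| <= e * s ^+ 2.
Proof.
move=> c0 t0 e0.
have c1 : c - 1 - 1 = c - 2 by ring.
have [r0 r00 r0P] : exists2 r : R, 0 < r & forall s : R, `|s| < r ->
    `|(c - 1) * (s *: (1 : R) + t) `^ (c - 2) - (c - 1) * t `^ (c - 2)| <= e.
  have cf : {for (t : R), continuous (fun u : R => (c - 1) * u `^ (c - 2))}.
    by apply: continuousM; [exact: cst_continuous | exact: powR_continuous_at].
  have /cvgrPdist_le/(_ e e0)/nbhs_normP[r /= r0 rP] := cf.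
  exists r => // s sr; rewrite distrC; apply: rP => /=.
  by rewrite [s *: 1]mulr1 opprD addrCA subrr addr0 normrN.
pose r := Num.min r0 t; exists r; first by rewrite lt_min r00.
move=> s; rewrite lt_min => /andP[sr0 st].
have pos u : `|u| <= `|s| -> 0 < u *: (1 : R) + t.
  by move=> us; rewrite [u *: 1]mulr1; have := ler_norm (- u); rewrite normrN; lra.
have H1 u : `|u| <= `|s| -> `|(u *: (1 : R) + t) `^ (c - 1) - t `^ (c - 1)
    - (c - 1) * t `^ (c - 2) * u| <= e * `|u|.
  move=> us.
  have := @mean_value_bound R (fun u : R => (u *: (1 : R) + t) `^ (c - 1))
    (fun u : R => (c - 1) * (u *: (1 : R) + t) `^ (c - 2)) u
    ((c - 1) * t `^ (c - 2)) e.
  rewrite scale0r add0r; apply=> v vu; have vs := le_trans vu us.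
  split; last by apply: r0P; exact: le_lt_trans sr0.
  by rewrite -c1; apply: is_derive_powR_shift; exact: pos.
pose F u := c^-1 * (u *: (1 : R) + t) `^ c - (t `^ (c - 1) * u
  + (c - 1) * t `^ (c - 2) / 2 * u ^+ 2).
pose dF u := (u *: (1 : R) + t) `^ (c - 1) - (t `^ (c - 1)
  + (c - 1) * t `^ (c - 2) * u).
have dFP u : `|u| <= `|s| -> is_derive u (1 : R) F (dF u).
  move=> us.
  have d1 : is_derive u (1 : R) (c^-1 \*: (fun u : R => (u *: (1 : R) + t) `^ c))
      (c^-1 *: (c * (u *: (1 : R) + t) `^ (c - 1))).
    by apply: is_deriveZ; apply: is_derive_powR_shift; exact: pos.
  have d2 : is_derive u (1 : R) (fun u : R => t `^ (c - 1) * u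
      + (c - 1) * t `^ (c - 2) / 2 * u ^+ 2)
      (t `^ (c - 1) + (c - 1) * t `^ (c - 2) * u).
    apply: (@is_derive_quadratic _ R^o _ _ _ _ ((c - 1) * t `^ (c - 2) / 2)) => h.
    by rewrite [h *: 1]mulr1; field.
  have := is_deriveB d1 d2; rewrite [c^-1 *: _]mulrA mulVf // mul1r; exact.
have := @mean_value_bound R F dF s 0 (e * `|s|) _.
rewrite /F scale0r add0r mulr0 expr0n /= mulr0 addr0 subr0 mul0r subr0.
have -> : e * `|s| * `|s| = e * s ^+ 2 by rewrite -mulrA -expr2 real_normK ?num_real.
rewrite [s *: 1]mulr1 => H; apply: le_trans (H _).
  by rewrite (addrC t s) le_eqVlt; apply/orP; left; apply/eqP; congr (`|_|); ring.
move=> u us; split; first exact: dFP.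
rewrite /dF subr0 opprD addrA; apply: (le_trans (H1 u us)).
by rewrite ler_pM2l.
Qed.

(* At t = |x - z|^2 and c = 1 - s / 2 this is, up to a factor, the radial
   function |x - z|^(2 - s) / (2 - s), increasing for both signs of c; at
   t = 0 < c it vanishes. *)
Definition potential c t := t `^ c / c.

(** For [c < 0] the point 0 is excluded: [powR 0 c] is 0 by convention, whereas [t^c / c] tends to
    minus infinity. *)
Lemma potential_lt c s t : c != 0 -> 0 <= s -> (0 < c \/ 0 < s) -> s < t ->
  potential c s < potential c t.
Proof.
move=> c0 s0 [cp|sp] st; rewrite /potential.
  rewrite ltr_pM2r ?invr_gt0 //; apply: gt0_ltr_powR => //; rewrite nnegrE //.
  exact/ltW/(le_lt_trans s0).
have t0 : 0 < t by exact: lt_trans st.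
case: (ltP 0 c) => [cp|cn].
  by rewrite ltr_pM2r ?invr_gt0 //; apply: gt0_ltr_powR => //; rewrite nnegrE ltW.
have {cn} cn : 0 < - c by rewrite oppr_gt0 lt_neqAle c0.
rewrite -(opprK c); move: (- c) cn => {c0} c cp.
rewrite !powRN invrN !mulrN ltrN2 ltr_pM2r ?invr_gt0 // ltf_pV2 ?posrE ?powR_gt0 //.
by apply: gt0_ltr_powR => //; rewrite nnegrE ltW.
Qed.

Lemma potential_le c s t : c != 0 -> 0 <= s -> (0 < c \/ 0 < s) -> s <= t ->
  potential c s <= potential c t.
Proof.
move=> c0 s0 cs; rewrite le_eqVlt => /predU1P[-> //|st].
by apply: ltW; exact: potential_lt.
Qed.

Lemma potential_cont c t e : c != 0 -> 0 <= t -> (0 < c \/ 0 < t) -> 0 < e ->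
  exists2 r : R, 0 < r & forall s : R, 0 <= s -> `|s - t| < r ->
    `|potential c s - potential c t| <= e.
Proof.
move=> c0 t0 ct e0; have [tp|] := ltP 0 t.
  have cf : {for (t : R), continuous (potential c)}.
    by apply: continuousM; [exact: powR_continuous_at | exact: cst_continuous].
  have /cvgrPdist_le/(_ e e0)/nbhs_normP[r /= r0 rP] := cf.
  by exists r => // s s0 sr; rewrite distrC; apply: rP => /=; rewrite distrC.
move=> tn; have {tn} tE : t = 0 by apply/eqP; rewrite eq_le tn.
have cp : 0 < c by case: ct => //; rewrite tE ltxx.
(* At [t = 0] the modulus is the solution [r] of [r^c / c = e]. *)
rewrite {}tE in t0 ct *; exists ((e * c) `^ c^-1); first by rewrite powR_gt0 // mulr_gt0.
move=> s s0; rewrite subr0 ger0_norm // => sr.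
rewrite /potential powR0 // mul0r subr0 ger0_norm ?divr_ge0 ?powR_ge0 ?(ltW cp) //.
rewrite ler_pdivrMr // -[leRHS]powRr1 ?mulr_ge0 ?(ltW e0) ?(ltW cp) //.
rewrite -(mulVf c0) powRrM; apply: powR_le => //; exact: ltW.
Qed.

End PowR.

Section Radial.
Variables (R : realType) (n : nat).
Implicit Types (p d z x y D : 'rV[R]_n) (X Y : 'M[R]_n).

Lemma enormE d : enorm d = Num.sqrt (dotv d d).
Proof. by rewrite /enorm dotvE; congr Num.sqrt; apply: eq_bigr => i _; rewrite expr2. Qed.

Lemma tensZ (a : R) d : tens (a *: d) = a ^+ 2 *: tens d.
Proof. by rewrite /tens [(_ *: _)^T]linearZ /= -scalemxAr -scalemxAl scalerA expr2. Qed.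

Lemma dotv_tens D d : dotv (d *m tens D) d = dotv D d ^+ 2.
Proof.
rewrite /dotv /tens mulmxA -mulmxA [LHS]mxE big_ord1 expr2.
by congr (_ * _); rewrite -[LHS]/(dotv d D) dotvC.
Qed.

(** [powR_taylor] is composed with the increment [sg] of the squared distance; [c - 1 = - s / 2] is
    what produces the coefficient [- s / t] of [tens D]. *)
Lemma radial_expand D (s e : R) : let c := 1 - s / 2 in let t := dotv D D in
  c != 0 -> 0 < t -> 0 < e ->
  \forall d \near (0 : 'rV[R]_n),
    `|potential c (dotv (D + d) (D + d)) - potential c t -
      quad ((2 * t `^ (c - 1)) *: D)
           ((2 * t `^ (c - 1)) *: (1%:M - (s / t) *: tens D)) d| <= e * dotv d d.
Proof.
move=> c t c0 t0 e0.
(* [L] bounds [|sg| / |d|] for [|d| <= 1], and [K] is the size of the second-order coefficient; the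
   radius below makes each of two errors at most [e / 2 * dotv d d]. *)
pose L := n%:R * (2 * `|D| + 1); pose K := `|(c - 1) * t `^ (c - 2) / 2|.
have L0 : 0 <= L by rewrite mulr_ge0 // addr_ge0 // mulr_ge0.
have K0 : 0 <= K by exact: normr_ge0.
have L1 : 0 < L + 1 by rewrite ltr_wpDl.
have LL1 : 0 < 2 * (L ^+ 2 + 1) by rewrite mulr_gt0 // ltr_wpDl // exprn_ge0.
have KL1 : 0 < 4 * (K * L + 1) by rewrite mulr_gt0 // ltr_wpDl // mulr_ge0.
have [r1 r10 r1P] := powR_taylor c0 t0 (divr_gt0 e0 LL1).
apply/near0P; exists (Num.min 1 (Num.min (r1 / (L + 1)) (e / (4 * (K * L + 1))))).
  by rewrite !lt_min ltr01 !divr_gt0.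
move=> d; rewrite !lt_min => /and3P[d1]; rewrite !ltr_pdivlMr // => d2 d3.
have dd0 := dotv_ge0 d; have nd0 := normr_ge0 d.
pose sg := 2 * dotv D d + dotv d d.
have tsg : dotv (D + d) (D + d) = t + sg.
  by rewrite /sg /t !(dotvDl, dotvDr) (dotvC d D); ring.
have Dd : `|dotv D d| <= n%:R * `|D| * `|d| by exact: dotv_norm.
have dd : dotv d d <= n%:R * `|d|.
  apply: (le_trans (ler_norm _)); apply: (le_trans (dotv_norm _ _)).
  by rewrite ler_wpM2r // ler_piMr // ltW.
have sgL : `|sg| <= L * `|d|.
  apply: (le_trans (ler_normD _ _)); rewrite normrM (ger0_norm (ltW _)) ?(ger0_norm dd0) //.
  rewrite /L; move: Dd dd; set a := `|dotv D d|; lra.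
have sg4 : `|4 * dotv D d + dotv d d| <= 2 * L * `|d|.
  apply: (le_trans (ler_normD _ _)); rewrite normrM (ger0_norm dd0) ger0_norm //.
  rewrite /L; move: Dd dd; set a := `|dotv D d|.
  have := mulr_ge0 (ler0n R n) nd0; lra.
have sq : sg ^+ 2 <= L ^+ 2 * dotv d d.
  rewrite -(real_normK (num_real sg)).
  apply: (@le_trans _ _ ((L * `|d|) ^+ 2)).
    by rewrite ler_pXn2r ?nnegrE // mulr_ge0.
  by rewrite exprMn ler_wpM2l ?exprn_ge0 // norm_dotv.
have sgr : `|sg| < r1.
  by apply: (le_lt_trans sgL); apply: le_lt_trans d2; rewrite mulrC ler_wpM2l // lerDl.
have c2 : t `^ (c - 2) = t `^ (c - 1) / t.
  have -> : c - 2 = (c - 1) - 1 by ring.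
  by rewrite powRB ?powRr1 ?(ltW t0) // (gt_eqF t0) implybT.
have Q : quad ((2 * t `^ (c - 1)) *: D)
           ((2 * t `^ (c - 1)) *: (1%:M - (s / t) *: tens D)) d
    = t `^ (c - 1) * sg + (c - 1) * t `^ (c - 2) * (2 * dotv D d ^+ 2).
  rewrite quadZ /quad mulmxBr mulmx1 -scalemxAr dotvBl dotvZl dotv_tens c2 /sg /c.
  by field; rewrite gt_eqF.
have := r1P sg sgr; rewrite -/(potential c (t + sg)) -/(potential c t) -tsg => Ht.
rewrite Q.
(* Replacing [sg^2] by [4 (dotv D d)^2] leaves [(4 dotv D d + dotv d d) dotv d d], a term of third
   order. *)
have -> : potential c (dotv (D + d) (D + d)) - potential c t -
    (t `^ (c - 1) * sg + (c - 1) * t `^ (c - 2) * (2 * dotv D d ^+ 2)) =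
  (potential c (dotv (D + d) (D + d)) - potential c t - t `^ (c - 1) * sg
    - (c - 1) * t `^ (c - 2) * sg ^+ 2 / 2)
  + (c - 1) * t `^ (c - 2) / 2 * ((4 * dotv D d + dotv d d) * dotv d d).
  by rewrite /sg; field.
have -> : e * dotv d d = e / 2 * dotv d d + e / 2 * dotv d d by field.
apply: (le_trans (ler_normD _ _)); apply: lerD.
  apply: (le_trans Ht); apply: (@le_trans _ _ (e / (2 * (L ^+ 2 + 1)) * (L ^+ 2 * dotv d d))).
    by rewrite ler_wpM2l // divr_ge0 ?(ltW e0) ?(ltW LL1).
  rewrite mulrA ler_wpM2r //.
  rewrite mulrAC ler_pdivrMr // -mulrA ler_pM2l //; lra.
rewrite normrM -/K normrM (ger0_norm dd0) mulrA ler_wpM2r //.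
apply: (@le_trans _ _ (K * (2 * L * `|d|))); first by rewrite ler_wpM2l.
have : 0 <= `|d| by []. lra.
Qed.

(** Homogeneity reduces [D] to the unit vector [e = D / |D|] at the price of the factor [Q t]. As
    [s > 1], both powers of [t] in [Q] have negative exponents, so [Q t >= Q T], which gives a
    uniform [kappa]. *)
Lemma radial_sign (H : 'rV[R]_n -> 'M[R]_n -> R) (k1 : R) (k2 : nat) (s mu T : R) :
  condB H k1 k2 -> 1 < s -> 0 < mu -> 0 < T ->
  (forall e, enorm e = 1 -> H e (1%:M - s *: tens e) <= - mu) ->
  (forall e, enorm e = 1 -> mu <= H e (s *: tens e - 1%:M)) ->
  exists2 kappa : R, 0 < kappa & forall D, let t := dotv D D in 0 < t -> t <= T ->
    let p := (2 * t `^ (- s / 2)) *: D in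
    let X := (2 * t `^ (- s / 2)) *: (1%:M - (s / t) *: tens D) in
    [/\ symmx X, H p X <= - kappa & 0 <= H (- p) (- X)].
Proof.
move=> [k10 k2odd Hp HX] s1 mu0 T0 Hup Hlow.
pose Q (t : R) := (2 * t `^ ((1 - s) / 2)) `^ k1 * (2 * t `^ (- s / 2)) ^+ k2.
have Q0 t : 0 < t -> 0 < Q t.
  by move=> t0; rewrite mulr_gt0 ?exprn_gt0 ?powR_gt0 ?mulr_gt0 ?powR_gt0.
exists (Q T * mu); first by rewrite mulr_gt0 // Q0.
move=> D t t0 tT p X.
have QT : Q T <= Q t.
  have h1 : 2 * T `^ ((1 - s) / 2) <= 2 * t `^ ((1 - s) / 2).
    by rewrite ler_pM2l //; apply: powR_anti => //; lra.
  have h2 : 2 * T `^ (- s / 2) <= 2 * t `^ (- s / 2).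
    by rewrite ler_pM2l //; apply: powR_anti => //; lra.
  apply: ler_pM; rewrite ?powR_ge0 ?exprn_ge0 ?mulr_ge0 ?powR_ge0 //.
    by apply: powR_le => //; rewrite mulr_ge0 ?powR_ge0.
  by rewrite lerXn2r ?nnegrE ?mulr_ge0 ?powR_ge0.
pose tau := Num.sqrt t; have tau0 : 0 < tau by rewrite sqrtr_gt0.
have tau2 : tau ^+ 2 = t by rewrite sqr_sqrtr // ltW.
pose e := tau^-1 *: D.
have De : D = tau *: e by rewrite scalerA mulfV ?gt_eqF // scale1r.
have te : tens e = t^-1 *: tens D by rewrite tensZ exprVn tau2.
have ne : enorm e = 1.
  rewrite enormE dotvZl dotvZr -/t mulrA -expr2 exprVn tau2 mulVf ?gt_eqF //.
  exact: sqrtr1.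
pose A := 2 * t `^ (- s / 2).
have A0 : 0 < A by rewrite mulr_gt0 // powR_gt0.
have Atau : A * tau = 2 * t `^ ((1 - s) / 2).
  rewrite /A /tau -powR12_sqrt ?(ltW t0) // -mulrA -powRD ?(gt_eqF t0) ?implybT //.
  by congr (_ * _ `^ _); field.
have pE : p = (A * tau) *: e by rewrite /p De scalerA.
have XE : X = A *: (1%:M - s *: tens e) by rewrite /X te scalerA.
have NXE : - X = A *: (s *: tens e - 1%:M) by rewrite XE -scalerN opprB.
have sT : symmx (s *: tens e) by apply: symmxZ; exact: tens_sym.
have s1M : symmx (1%:M : 'M[R]_n) by exact: symmx_scalar.
have sM : symmx (1%:M - s *: tens e) by apply: symmxD => //; exact: symmxN.
have sN : symmx (s *: tens e - 1%:M) by apply: symmxD => //; exact: symmxN.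
have sX : symmx X by rewrite XE; exact: symmxZ.
have At0 : 0 < A * tau by rewrite mulr_gt0.
split => //.
  rewrite pE Hp // XE HX // gtr0_norm // Atau mulrA -/A -/(Q t).
  have h : Q t * H e (1%:M - s *: tens e) <= Q t * - mu.
    by rewrite ler_pM2l ?Q0 //; exact: Hup.
  apply: (le_trans h); rewrite mulrN lerN2 ler_pM2r //.
rewrite pE -scaleNr Hp; last exact: symmxN.
rewrite NXE HX // !mulr_ge0 ?powR_ge0 ?exprn_ge0 ?(ltW A0) //.
by rewrite (le_trans (ltW mu0)) // Hlow.
Qed.

(** [sup] and [inf] are bounds only for bounded sets of values; extrema over the compact sphere
    provide boundedness. *)
Lemma m2_sphere (H : 'rV[R]_n -> 'M[R]_n -> R) (s : R) : admissible H ->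
  (0 < n)%N -> m2 H s < 0 ->
  (forall e, enorm e = 1 -> H e (1%:M - s *: tens e) <= m2 H s) /\
  (forall e, enorm e = 1 -> - m2 H s <= H e (s *: tens e - 1%:M)).
Proof.
move=> Hadm n0 m20.
have cst : continuous (fun e => s *: @tens R n e).
  by move=> e; exact: (continuous_comp (@tens_continuous R n e) (@scaler_continuous _ _ s _)).
have cH (M : 'rV[R]_n -> 'M[R]_n) : continuous M -> (forall e, symmx (M e)) ->
    cont_on (@esphere R n) (fun e => H e (M e)).
  move=> cM sM x _ e e0; have [r r0 rP] := operator_continuous Hadm x (sM x) e0.
  have /cvgrPdist_lt/(_ r r0) nM := cM x.
  have nx : \forall y \near x, `|y - x| < r by apply/near_distP; exists r.
  apply: filterS2 nM nx => y My yx _; apply: rP => //.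
  by rewrite distrC.
have sT e : symmx (s *: @tens R n e) by apply: symmxZ; exact: tens_sym.
have s1M : symmx (1%:M : 'M[R]_n) by exact: symmx_scalar.
have := cH (fun e => 1%:M - s *: tens e) _ _.
have := cH (fun e => s *: tens e - 1%:M) _ _.
move=> /(_ (fun e => cvgB (cst e) (cvg_cst _)) (fun e => symmxD (sT e) (symmxN s1M))) c1.
move=> /(_ (fun e => cvgB (cvg_cst _) (cst e)) (fun e => symmxD s1M (symmxN (sT e)))) c2.
have [e1 _ e1P] := cont_on_argmax (esphere_neq0 R n0) (@esphere_compact R n) c2.
have [e2 _ e2P] := cont_on_argmax (esphere_neq0 R n0) (@esphere_compact R n) (cont_onN c1).
split=> e eS.
  rewrite /m2 le_max; apply/orP; left; apply: ub_le_sup; last by exists e.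
  by exists (H e1 (1%:M - s *: tens e1)) => _ [e' e'S <-]; exact: e1P.
rewrite lerNl /m2 le_max; apply/orP; right; rewrite lerN2.
apply: ge_inf; last by exists e.
by exists (H e2 (s *: tens e2 - 1%:M)) => _ [e' e'S <-]; rewrite -lerN2; exact: e2P.
Qed.

End Radial.

(** * Boundary behaviour of the Perron class from barriers *)

Section Barriers.
Variables (R : realType) (n : nat) (Omega : set 'rV[R]_n).
Variables (H : 'rV[R]_n -> 'M[R]_n -> R) (k : R).
Variables (b U h : 'rV[R]_n -> R) (c0 B M : R).
Implicit Types (p d x y z : 'rV[R]_n) (X Y : 'M[R]_n) (w g : 'rV[R]_n -> R).

(** One function serves both sides: with [H p X <= - kappa] a large multiple beats the zero-order
    term, and [0 <= H (- p) (- X)] makes negative multiples subsolutions where the zero-order term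
    is nonnegative. The lower bound [m] lets a multiple exceed any constant away from [y]. *)
Definition barrier (kappa : R) g y : Prop :=
  [/\ cont_on (closure Omega) g, g y = 0,
      forall x, closure Omega x -> 0 <= g x,
      forall eta : R, 0 < eta -> exists2 m : R, 0 < m &
        forall x, closure Omega x -> eta <= `|x - y| -> m <= g x &
      forall x, Omega x -> exists p X,
        [/\ symmx X, H p X <= - kappa, 0 <= H (- p) (- X) &
            forall e : R, 0 < e -> \forall d \near (0 : 'rV[R]_n),
              `|g (x + d) - g x - quad p X d| <= e * dotv d d]].

Hypothesis oO : open Omega.
Hypothesis bO : bounded_set Omega.
Hypothesis Hadm : admissible H.
Hypothesis HA : condA H.
Hypothesis k0 : 0 < k.
Hypothesis Hhom : forall (t : R) p X, symmx X -> 0 < t ->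
  H (t *: p) (t *: X) = t `^ k * H p X.
Hypothesis bpos : forall x, Omega x -> 0 < b x.
Hypothesis bB : forall x, Omega x -> b x <= B.
Hypothesis c0pos : 0 < c0.
Hypothesis UM : forall x, closure Omega x -> U x <= M.
Hypothesis hc : cont_on (boundary Omega) h.
Hypothesis hge : forall x, boundary Omega x -> c0 <= h x.
Hypothesis hU : forall x y, closure Omega x -> boundary Omega y -> h y <= U x.
Hypothesis Hbar : forall y, boundary Omega y ->
  exists2 kappa : R, 0 < kappa & exists g, barrier kappa g y.

Let bdE x : boundary Omega x <-> closure Omega x /\ ~ Omega x.
Proof. by rewrite boundary_openE. Qed.

Lemma exists_large (kappa N : R) : 0 < kappa -> exists C : R, [/\ 0 < C, N <= C & N < kappa * C `^ k].
Proof.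
move=> kappa0; pose C0 := ((`|N| + 1) / kappa) `^ k^-1.
exists (`|N| + 1 + C0).
have N1 : 0 < `|N| + 1 by rewrite ltr_wpDl.
have C00 : 0 <= C0 by exact: powR_ge0.
have NN := ler_norm N.
split; [lra | lra |].
have : C0 `^ k <= (`|N| + 1 + C0) `^ k.
  by apply: powR_le; [exact: ltW | | lra].
rewrite /C0 -powRrM mulVf ?gt_eqF // powRr1; last by rewrite divr_ge0 // ltW.
rewrite ler_pdivrMr // mulrC => h1; lra.
Qed.

(** Every member lies below [h y + e / 2 + C g]: an interior maximum of [w - C g] would give
    [0 <= - kappa C^k + B M^k]. The ceiling [M] common to the class allows [C] to be fixed before
    [w]. *)
Lemma upper_barrier y (e : R) : boundary Omega y -> 0 < e ->
  \forall x \near y, closure Omega x ->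
    forall w, perron_class Omega H k b U h c0 w -> w x <= h y + e.
Proof.
move=> by_ e0; have [cly _] := (bdE y).1 by_.
have M0 : 0 < M by apply: lt_le_trans c0pos _; apply: (le_trans (hge by_)); apply: (le_trans (hU cly by_)); exact: UM.
have hy0 : 0 < h y by apply: lt_le_trans c0pos _; exact: hge.
have [kappa kappa0 [g [gc gy g0 gm gJ]]] := Hbar by_.
have e2 : 0 < e / 2 by rewrite divr_gt0.
have /near_distP[eta eta0 etaP] := hc by_ e2.
have [m m0 mP] := gm eta eta0.
(* [C m >= M] settles the boundary points away from [y], and [kappa C^k > B M^k] the interior
   points. *)
have [C [C0 CM CB]] := exists_large (Num.max (M / m) (B * M `^ k)) kappa0.
move: CM CB; rewrite ge_max gt_max => /andP[CM _] /andP[_ CB].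
rewrite ler_pdivrMr // in CM.
suff wle w x : perron_class Omega H k b U h c0 w -> closure Omega x ->
    w x <= h y + e / 2 + C * g x.
  have gC := cont_onZ C gc.
  apply: filterS (gC y cly _ e2) => x gx clx w wS; have := gx clx.
  rewrite gy mulr0 subr0 ler_norml => /andP[_ ?].
  by have := wle w x wS clx; lra.
move=> wS; have [wc wb wh ws] := wS.
have fc : cont_on (closure Omega) (fun x => w x + - (C * g x)).
  by apply: cont_onD => //; apply: cont_onN; exact: cont_onZ.
have [x1 clx1 x1max] : exists2 x1, closure Omega x1 & forall x, closure Omega x ->
    w x + - (C * g x) <= w x1 + - (C * g x1).
  by apply: (cont_on_argmax _ _ fc); [exists y | exact: bounded_closure_compact].
suff f1 : w x1 - C * g x1 <= h y + e / 2.
  by move=> clx; have := x1max x clx; lra.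
have wM : w x1 <= M by have /andP[_ /le_trans] := wb x1 clx1; apply; exact: UM.
have Cg : 0 <= C * g x1 by rewrite mulr_ge0 ?(ltW C0) // g0.
case: (pselect (Omega x1)) => [Ox1|nOx1]; last first.
  have bx1 : boundary Omega x1 by apply/bdE.
  have [xy|xy] := ltP `|x1 - y| eta.
    have := etaP x1 xy bx1; rewrite ler_norml => /andP[_ ?].
    by have := wh x1 bx1; lra.
  have : C * m <= C * g x1 by rewrite ler_pM2l //; exact: mP.
  lra.
exfalso.
have [p [X [sX Hle _ gexp]]] := gJ x1 Ox1.
have sCX : symmx (C *: X) by exact: symmxZ.
have : 0 <= H (C *: p) (C *: X) + b x1 * w x1 `^ k.
  apply: (jet_above_limit Hadm (u := w) (y := x1)) => //.
    by move=> Y sY; exact: ws.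
  move=> e' e'0.
  have nO : \forall x \near x1, Omega x by exact: open_nbhs_nbhs.
  have /near_shift0 nO' := nO.
  apply: filterS2 (gexp (e' / C) (divr_gt0 e'0 C0)) nO' => d gd Od.
  have := x1max (x1 + d) (@subset_closure _ _ _ Od).
  have : C * (g (x1 + d) - g x1 - quad p X d) <= C * (e' / C * dotv d d).
    by rewrite ler_pM2l //; move: gd; rewrite ler_norml => /andP[].
  have -> : C * (e' / C * dotv d d) = e' * dotv d d by field; rewrite gt_eqF.
  rewrite quadZ; lra.
rewrite Hhom //.
have : C `^ k * H p X <= C `^ k * - kappa by rewrite ler_pM2l // powR_gt0.
have : b x1 * w x1 `^ k <= B * M `^ k.
  apply: ler_pM => //; rewrite ?powR_ge0 ?(ltW (bpos Ox1)) //; first exact: bB.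
  apply: powR_le => //; first exact: ltW.
  by have /andP[/(le_trans (ltW c0pos))] := wb x1 clx1.
lra.
Qed.

(** Cutting [h y - e - C g] off at [c0] from below restores the floor; where the cut is inactive the
    function is positive, and both terms of the equation are nonnegative. *)
Lemma lower_barrier y (e : R) : boundary Omega y -> 0 < e ->
  exists2 w, perron_class Omega H k b U h c0 w & h y - e <= w y.
Proof.
move=> by_ e0; have [cly _] := (bdE y).1 by_.
have hy0 : 0 < h y by apply: lt_le_trans c0pos _; exact: hge.
have [kappa kappa0 [g [gc gy g0 gm gJ]]] := Hbar by_.
have /near_distP[eta eta0 etaP] := hc by_ e0.
have [m m0 mP] := gm eta eta0.
(* With [C m = h y] the function [L] is at most [- e] at distance [eta] or more from [y], hence
   below [h] there. *)
pose C := h y / m; have C0 : 0 < C by rewrite divr_gt0.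
have CmE : C * m = h y by rewrite /C divfK // gt_eqF.
clearbody C.
have Cg x : closure Omega x -> 0 <= C * g x.
  by move=> clx; rewrite mulr_ge0 ?(ltW C0) // g0.
pose L x := (h y - e) + - (C * g x).
exists (fun x => Num.max c0 (L x)); last first.
  by rewrite /L gy mulr0 subr0 le_max lexx orbT.
split.
- apply: cont_on_max; first exact: cont_on_cst.
  apply: cont_onD; first exact: cont_on_cst.
  by apply: cont_onN; exact: cont_onZ.
- move=> x clx; rewrite le_max lexx ge_max /=.
  have hyU := hU clx by_; rewrite (le_trans (hge by_) hyU) /=.
  by have := Cg x clx; rewrite /L; lra.
- move=> x bx; have [clx _] := (bdE x).1 bx.
  rewrite ge_max hge //= /L.
  have [xy|xy] := ltP `|x - y| eta.
    have := etaP x xy bx; rewrite ler_norml => /andP[? _].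
    by have := Cg x clx; lra.
  have : C * m <= C * g x by rewrite ler_pM2l //; exact: mP.
  by have := lt_le_trans c0pos (hge bx); lra.
- move=> x Ox p' Y sY J; case: (leP c0 (L x)) => cL; last first.
    apply: (sub_at_cst k Hadm HA bpos Ox (ltW c0pos)) => //.
    apply: jet_above_le J; first by apply/esym/max_idPl; exact: ltW.
    by apply/near0P; exists 1 => // d _; rewrite le_max lexx.
  have L0 : 0 <= b x * L x `^ k by rewrite mulr_ge0 ?powR_ge0 // ltW // bpos.
  have {}J : jet_above L x p' Y.
    apply: jet_above_le J; first exact/esym/max_idPr.
    by apply/near0P; exists 1 => // d _; rewrite le_max lexx orbT.
  have [p [X [sX _ Hge gexp]]] := gJ x Ox.
  have sNX : symmx (- X) by exact: symmxN.
  have sCX : symmx (C *: - X) by exact: symmxZ.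
  have [<- XY] : C *: - p = p' /\ lemx (C *: - X) Y.
    apply: quad_touch => e' e'0.
    apply: filterS2 (gexp (e' / C) (divr_gt0 e'0 C0)) J => d gd.
    rewrite /L quadZ quadN.
    have : C * (g (x + d) - g x - quad p X d) <= C * (e' / C * dotv d d).
      by rewrite ler_pM2l //; move: gd; rewrite ler_norml => /andP[].
    have -> : C * (e' / C * dotv d d) = e' * dotv d d by field; rewrite gt_eqF.
    lra.
  rewrite addr_ge0 //; apply: le_trans (HA _ sCX sY XY).
  by rewrite Hhom // mulr_ge0 // powR_ge0.
Qed.

End Barriers.

(** * Existence of barriers *)

Section BarrierExistence.
Variables (R : realType) (n : nat).
Implicit Types (p d x y z : 'rV[R]_n) (X Y : 'M[R]_n) (Omega : set 'rV[R]_n).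

Lemma cont_on_dotv (A : set 'rV[R]_n) z : cont_on A (fun x => dotv (x - z) (x - z)).
Proof.
have -> : (fun x => dotv (x - z) (x - z)) = (fun x => quad 0 (2 * 1)%:M (x - z)).
  apply/funext => x; have := quad_scalar 0 0 1 (x - z); rewrite add0r => ->.
  by rewrite /quad mulmx0 !dotv0l mul0r !add0r mul1r.
exact/cont_on_quad/symmx_scalar.
Qed.

(* The ball of half the radius, internally tangent at y, touches the closure
   of Omega at y only, with quadratic separation. *)
Lemma outer_ball_point Omega y : boundary Omega y -> uniform_outer_ball Omega ->
  exists2 z, 0 < dotv (y - z) (y - z) & forall x, closure Omega x ->
    dotv (x - y) (x - y) / 2 + dotv (y - z) (y - z) <= dotv (x - z) (x - z).
Proof.
move=> by_ [rho rho0 /(_ y by_) [z [zO [clzy _]]]].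
have ec : continuous (fun x : 'rV[R]_n => enorm (x - z)).
  move=> x; apply: (@continuous_comp _ _ _ (fun x => x - z) (@enorm R n)).
    exact: (cvgB cvg_id (cvg_cst _)).
  exact: enorm_continuous.
have sqE d : dotv d d = enorm d ^+ 2 by rewrite enormE sqr_sqrtr // dotv_ge0.
have clge x : closure Omega x -> rho <= enorm (x - z).
  have c1 : closed [set x : 'rV[R]_n | rho <= enorm (x - z)].
    apply: (preimage_closed (f := fun x : 'rV[R]_n => enorm (x - z)) (D := [set t : R | rho <= t])).
      by move=> x' _; exact: ec.
    exact: closed_ge.
  have sub : Omega `<=` [set x : 'rV[R]_n | rho <= enorm (x - z)].
    by move=> x' Ox' /=; rewrite leNgt; apply/negP => /zO.
  by move=> /(closure_subset sub); rewrite -(closure_id _).1.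
have yle : enorm (y - z) <= rho.
  have c1 : closed [set x : 'rV[R]_n | enorm (x - z) <= rho].
    apply: (preimage_closed (f := fun x : 'rV[R]_n => enorm (x - z)) (D := [set t : R | t <= rho])).
      by move=> x' _; exact: ec.
    exact: closed_le.
  have sub : eball z rho `<=` [set x : 'rV[R]_n | enorm (x - z) <= rho].
    by move=> x' /= /ltW.
  by move: clzy => /(closure_subset sub); rewrite -(closure_id _).1.
have yge : rho <= enorm (y - z) by apply: clge; have [] := by_.
have yz : y - 2^-1 *: (y + z) = 2^-1 *: (y - z).
  by apply/rowP => i; rewrite !mxE; field.
exists (2^-1 *: (y + z)).
  have eyz : 0 < enorm (y - z) by exact: lt_le_trans rho0 yge.
  by rewrite yz dotvZl dotvZr sqE !mulr_gt0 ?invr_gt0.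
move=> x clx; rewrite yz.
have -> : x - 2^-1 *: (y + z) = (x - y) + 2^-1 *: (y - z).
  by rewrite -yz addrA subrK.
have xz := clge x clx.
have h : dotv (y - z) (y - z) <= dotv (x - z) (x - z).
  by rewrite !sqE ler_pXn2r ?nnegrE ?sqrtr_ge0 //; exact: le_trans yle xz.
move: h; have -> : x - z = (x - y) + (y - z) by rewrite addrA subrK.
(* From [|u + v|^2 >= |v|^2] follows [u.v >= - |u|^2 / 2], and then
   [|u + v/2|^2 >= |u|^2 / 2 + |v/2|^2]. *)
move: (x - y) (y - z) => u v.
rewrite !(dotvDl, dotvDr, dotvZl, dotvZr) (dotvC v u); lra.
Qed.

(** For [s < 2] the potential is finite at its pole [z], so [z = y] is allowed; for [s > 2] the pole
    must be kept away from the closure, which positivity of [|y - z|] and the separation hypothesis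
    ensure. *)
Lemma barrier_exists Omega (H : 'rV[R]_n -> 'M[R]_n -> R) (k1 : R) (k2 : nat)
    (s : R) y z :
  open Omega -> bounded_set Omega -> (0 < n)%N -> admissible H -> condB H k1 k2 ->
  1 < s -> s != 2 -> m2 H s < 0 -> boundary Omega y ->
  (s < 2 \/ 0 < dotv (y - z) (y - z)) ->
  (forall x, closure Omega x ->
    dotv (x - y) (x - y) / 2 + dotv (y - z) (y - z) <= dotv (x - z) (x - z)) ->
  exists2 kappa : R, 0 < kappa & exists g, barrier Omega H kappa g y.
Proof.
move=> oO bO n0 Hadm hB s1 s2 m2s by_ zcase zP.
have [cly nOy] : closure Omega y /\ ~ Omega y by move: by_; rewrite boundary_openE.
pose c := 1 - s / 2.
have c0 : c != 0 by apply: contra s2 => /eqP; rewrite /c => cE; apply/eqP; lra.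
pose ty := dotv (y - z) (y - z).
have ty0 : 0 <= ty by exact: dotv_ge0.
have cty : 0 < c \/ 0 < ty.
  by case: zcase => [s2'|]; [left; rewrite /c; lra | right].
pose q x := dotv (x - z) (x - z).
have qc A : cont_on A q by exact: cont_on_dotv.
have qty x : closure Omega x -> ty <= q x.
  by move=> clx; have := zP x clx; have := dotv_ge0 (x - y); rewrite -/ty -/(q x); lra.
have cq x : closure Omega x -> 0 < c \/ 0 < q x.
  by move=> clx; case: cty => [|ty1]; [left | right; exact: lt_le_trans (qty x clx)].
have [xT _ xTP] : exists2 x, closure Omega x & forall x', closure Omega x' -> q x' <= q x.
  by apply: cont_on_argmax => //; [exists y | exact: bounded_closure_compact].
have T0 : 0 < q xT + 1 by rewrite ltr_wpDl // dotv_ge0.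
have [Hup Hlow] := m2_sphere Hadm n0 m2s.
have mu0 : 0 < - m2 H s by rewrite oppr_gt0.
have Hup' e : enorm e = 1 -> H e (1%:M - s *: tens e) <= - - m2 H s.
  by rewrite opprK; exact: Hup.
have [kappa kappa0 HD] := radial_sign hB s1 mu0 T0 Hup' Hlow.
exists kappa => //; exists (fun x => potential c (q x) - potential c ty); split.
- move=> x clx e e0.
  have [r r0 rP] := potential_cont c0 (dotv_ge0 (x - z)) (cq x clx) e0.
  have r2 : 0 < r / 2 by rewrite divr_gt0.
  apply: filterS (qc _ x clx _ r2) => x' qx' clx'.
  rewrite opprB addrA subrK; apply: rP; first exact: dotv_ge0.
  by apply: le_lt_trans (qx' clx') _; rewrite ltr_pdivrMr // ltr_pMr // ltr1n.
- by rewrite subrr.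
- by move=> x clx; rewrite subr_ge0 potential_le // qty.
- move=> eta eta0; have e2 : 0 < eta ^+ 2 / 2 by rewrite divr_gt0 // exprn_gt0.
  have tlt : ty < ty + eta ^+ 2 / 2 by rewrite ltrDl.
  exists (potential c (ty + eta ^+ 2 / 2) - potential c ty).
    by rewrite subr_gt0 potential_lt.
  move=> x clx xy; rewrite lerD2r; apply: potential_le => //.
  + by rewrite addr_ge0 // ltW.
  + by case: cty; [left | right; rewrite addr_gt0].
  apply: le_trans (zP x clx); rewrite addrC lerD2r ler_pM2r ?invr_gt0 //.
  apply: le_trans (norm_dotv _); rewrite ler_pXn2r ?nnegrE //; exact: ltW.
move=> x Ox; have clx := @subset_closure _ _ _ Ox.
have xy : x - y != 0.
  by rewrite subr_eq0; apply: contra_not_neq nOy => <-.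
have qx0 : 0 < q x.
  by have := zP x clx; have := dotv_gt0 xy; rewrite -/ty -/(q x); lra.
have qT : q x <= q xT + 1 by rewrite (le_trans (xTP x clx)) // lerDl.
have [sX Hle Hge] := HD (x - z) qx0 qT.
do 2 eexists; split; [exact: sX | exact: Hle | exact: Hge |].
move=> e e0; have := radial_expand c0 qx0 e0.
have -> : 1 - s / 2 - 1 = - s / 2 by ring.
apply: filterS => d.
rewrite /q; have -> : x + d - z = x - z + d by rewrite addrAC.
by rewrite opprB addrA subrK.
Qed.

End BarrierExistence.

(** * Floor, ceiling and barriers for the given data *)

Theorem theorem1p5 (R : realType) (n : nat) (hn : (2 <= n)%N)
    (Omega : set 'rV[R]_n)
    (hOmega : domain Omega) (bOmega : bounded_set Omega)
    (H : 'rV[R]_n -> 'M[R]_n -> R) (k1 : R) (k2 : nat)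
    (hH : admissible H) (hA : condA H) (hB : condB H k1 k2) (hC : condC H k1 k2)
    (hcase : case_i H \/ (case_ii H /\ uniform_outer_ball Omega))
    (delta : R) (hdelta : 0 < delta)
    (a : 'rV[R]_n -> R)
    (ca : {within Omega, continuous a}) (ba : [bounded a x | x in Omega])
    (ha : 0 < inf [set a x | x in Omega])
    (h : 'rV[R]_n -> R)
    (ch : {within boundary Omega, continuous h})
    (hh : 0 < inf [set h x | x in boundary Omega])
    (lambda : R) (hlambda : 0 < lambda) :
  (exists u, positive_solution Omega H (k1 + k2%:R) lambda a (cst delta) u) ->
  exists v, positive_solution Omega H (k1 + k2%:R) lambda a h v.
Proof.
move=> [u [uc upos [_ _ usup] ubd]].
have [oO _ O0] := hOmega; have n0 : (0 < n)%N by exact: leq_trans hn.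
have clE x : Omega x -> closure Omega x by exact: subset_closure.
have bdE x : boundary Omega x <-> closure Omega x /\ ~ Omega x.
  by rewrite boundary_openE.
have ccl := bounded_closure_compact bOmega.
have [k10 k2odd Hp HX] := hB.
set k := k1 + k2%:R.
have k2_gt0 : 0 < k2%:R :> R by rewrite ltr0n lt0n; apply: contraTneq k2odd => ->.
have k0 : 0 < k by rewrite ltr_wpDl.
have Hhom (t : R) p X : symmx X -> 0 < t -> H (t *: p) (t *: X) = t `^ k * H p X.
  move=> sX t0; rewrite Hp; last exact: symmxZ.
  rewrite HX // gtr0_norm // mulrA /k powRD ?(gt_eqF t0) ?implybT //.
  by rewrite powR_mulrn // ltW.
(* On positive functions this brings the zero-order term to the form [b w^k] of the Perron class. *)
have powE (r : R) : 0 < r -> `|r| `^ (k - 1) * r = r `^ k.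
  by move=> r0; rewrite gtr0_norm // mulrC mulr_powRB1 // ltW.
have [Ma aM] : exists Ma : R, forall x, Omega x -> `|a x| <= Ma.
  have [Ma0 [_ aM0]] := ba; exists (Ma0 + 1) => x Ox.
  by apply: (aM0 (Ma0 + 1)) => //; rewrite ltrDl.
have apos x : Omega x -> 0 < a x.
  move=> Ox; apply: (lt_le_trans ha); apply: ge_inf; last by exists x.
  by exists (- Ma) => _ [x' Ox' <-]; have := aM x' Ox'; rewrite ler_norml => /andP[].
pose b x := lambda * a x.
have bc : cont_on Omega b by apply: cont_onZ; exact/cont_onP.
have bpos x : Omega x -> 0 < b x by move=> Ox; rewrite mulr_gt0 // apos.
have bB x : Omega x -> b x <= lambda * Ma.
  by move=> Ox; rewrite ler_pM2l //; apply: le_trans (aM x Ox); exact: ler_norm.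
have hc : cont_on (boundary Omega) h by exact/cont_onP.
have cbd : compact (boundary Omega) by exact: boundary_compact.
(* As [inf] of the empty set is 0, the positive infimum of [h] forces the boundary to be
   nonempty. *)
have bd0 : boundary Omega !=set0.
  apply: contrapT => nbd; move: hh; have -> : [set h x | x in boundary Omega] = set0.
    by apply/seteqP; split => // r [x bx hx]; case: nbd; exists x.
  by rewrite inf0 ltxx.
have [yM byM hM] := cont_on_argmax bd0 cbd hc.
have [ym bym hm] := cont_on_argmax bd0 cbd (cont_onN hc).
pose c0 := h ym.
have hge x : boundary Omega x -> c0 <= h x by move=> /hm; rewrite lerN2.
have c0pos : 0 < c0.
  apply: (lt_le_trans hh); apply: ge_inf; last by exists ym.
  by exists c0 => _ [x bx <-]; exact: hge.
have u_cont : cont_on (closure Omega) u by exact/cont_onP.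
(* Minimum principle: an interior minimum is touched from below by a constant, and [H 0 0 = 0]
   leaves [b u^k <= 0], against positivity. *)
have udelta x : closure Omega x -> delta <= u x.
  have cl0 : closure Omega !=set0 by have [x0 Ox0] := O0; exists x0; exact: clE.
  have [x1 clx1 x1min] := cont_on_argmax cl0 ccl (cont_onN u_cont).
  move=> clx; have : u x1 <= u x by have := x1min x clx; rewrite lerN2.
  apply: le_trans; case: (pselect (Omega x1)) => [Ox1|nOx1]; last first.
    by rewrite ubd //; apply/bdE.
  have s0 : symmx (0 : 'M[R]_n) by rewrite /symmx /= trmx0.
  have J : jet_below u x1 0 0.
    have nO : \forall x \near x1, Omega x by exact: open_nbhs_nbhs.
    have /near_shift0 nO' := nO; apply: filterS nO' => d Od.
    rewrite /quad mulmx0 !dotv0l mul0r !addr0.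
    by have := x1min _ (clE _ Od); rewrite lerN2.
  have := viscosity_super_jet usup Ox1 s0 J.
  have [_ ->] := hH; rewrite add0r -mulrA powE; last exact: upos.
  have : 0 < b x1 * u x1 `^ k by rewrite mulr_gt0 ?bpos // powR_gt0 // upos.
  by rewrite /b; lra.
pose t := h yM / delta.
have hM0 : 0 < h yM by apply: (lt_le_trans c0pos); exact: hge.
have t0 : 0 < t by rewrite divr_gt0.
pose U x := t * u x.
have Uc : cont_on (closure Omega) U by exact: cont_onZ.
have hU x y : closure Omega x -> boundary Omega y -> h y <= U x.
  move=> clx by_; apply: (le_trans (hM y by_)).
  by rewrite /U /t mulrAC ler_pdivlMr // ler_pM2l // udelta.
have Uge x : closure Omega x -> c0 <= U x.
  by move=> clx; apply: hU.
have Usuper y p X : Omega y -> symmx X -> jet_below U y p X ->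
    H p X + b y * U y `^ k <= 0.
  move=> Oy sX J; have sX' : symmx (t^-1 *: X) by exact: symmxZ.
  have J' : jet_below u y (t^-1 *: p) (t^-1 *: X).
    apply: filterS J => d; rewrite /U quadZ => Jd.
    by rewrite -(ler_pM2l t0) mulrDr mulrA mulfV ?gt_eqF // mul1r.
  have uy := upos y (clE _ Oy).
  have := viscosity_super_jet usup Oy sX' J'.
  rewrite -mulrA powE // -/(b y).
  have -> : H p X = t `^ k * H (t^-1 *: p) (t^-1 *: X).
    by rewrite -Hhom // !scalerA mulfV ?gt_eqF // !scale1r.
  rewrite /U powRM ?(ltW t0) ?(ltW uy) // mulrCA -mulrDr => h1.
  by rewrite pmulr_rle0 // powR_gt0.
have [xM clxM UM] : exists2 x, closure Omega x & forall x', closure Omega x' -> U x' <= U x.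
  by apply: cont_on_argmax => //; have [x0 Ox0] := O0; exists x0; exact: clE.
have Hbar y : boundary Omega y ->
    exists2 kappa : R, 0 < kappa & exists g, barrier Omega H kappa g y.
  move=> by_; case: hcase => [[s [s1 s2 m2s]]|[[s [s2 m2s]] ball]].
    (* For [s < 2] the pole is the boundary point itself, which puts no condition on the domain. *)
    apply: (@barrier_exists _ _ Omega H k1 k2 s y y) => //.
    - by rewrite lt_eqF.
    - by left.
    move=> x _; rewrite subrr dotv0l addr0.
    by have := dotv_ge0 (x - y); lra.
  have [z yz zP] := outer_ball_point by_ ball.
  (* Here [s] is only the threshold of Case (ii); [s + 1] lies strictly beyond it and exceeds 2. *)
  apply: (@barrier_exists _ _ Omega H k1 k2 (s + 1) y z) => //.
  - lra.
  - by apply/eqP; lra.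
  - by apply: m2s; rewrite ltrDl.
  - by right.
have hup := upper_barrier oO bOmega hH k0 Hhom bpos bB c0pos UM hc hge hU Hbar.
have hlow := lower_barrier oO hH hA Hhom bpos c0pos hc hge hU Hbar.
have [vc _ _ vsub] := envelope_class oO bOmega hH hA k0 Hhom bc bpos c0pos Uc Uge hge hup hlow.
exists (envelope Omega H k b U h c0).
set v := envelope _ _ _ _ _ _ _ in vc vsub *.
have vpos x : closure Omega x -> 0 < v x by move=> clx; exact: envelope_gt0.
split => //.
- exact/cont_onP.
- split.
  + by apply/cont_onP; apply: cont_onW vc => x; exact: clE.
  + apply: (viscosity_sub_of_jets hH) => // y p X Oy sX J.
    by rewrite -mulrA powE; [exact: vsub | exact/vpos/clE].
  + apply: (viscosity_super_of_jets hH) => // y p X Oy sX J.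
    rewrite -mulrA powE; last exact/vpos/clE.
    exact: (envelope_super oO bOmega hH hA k0 Hhom bc bpos c0pos Uc Uge Usuper hge hup hlow).
- by move=> x bx; exact: (envelope_boundary oO hH hA bpos c0pos Uge hge hup hlow bx).
Qed.
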